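(* Let $\sigma=\mathcal{O}(E)$ be a stratum of an orthant space $X^m$, let $x^*\in\sigma$ and let $x$ be a fixed choice of point anywhere in $X^m$. (i) If $w\in\mathbb{R}(E)$ is tangent to $\sigma$ at $x^*$, then $\lim_{\lambda\to0+}\Phi(x;x^*(\lambda,w))=\Phi(x;x^* )$. (ii) If $\sigma$ bounds $\tau=\mathcal{O}(E\cup F)$ in $X^m$ and $w_\tau\in\mathbb{R}(E)\times\mathcal{O}(F)$ is tangent to $\tau$ at $x^*$, then the limit $$\Psi(x,w_\tau;x^* )=\lim_{\lambda\to0+}\Phi(x;x^*(\lambda,w_\tau))$$ exists. Moreover, there exist $\epsilon>0$ and sequences $\mathcal{A}=(A_0,A_1,\dots,A_k)$ and $\mathcal{B}=(B_0,B_1,\dots,B_k)$ of sets of axes such that, for each $\lambda\in(0,\epsilon)$, $(\mathcal{A},\mathcal{B})$ forms the support of the geodesic from $x^*(\lambda,w_\tau)$ to $x$. In terms of these $\mathcal{A}$ and $\mathcal{B}$, $$\Psi(x,w_\tau;x^* )=\jmath\left(P_{B_0}(x),\,-\frac{\|P_{B_1}(x)\|}{\|W_1\|}W_1,\,\dots,\,-\frac{\|P_{B_k}(x)\|}{\|W_k\|}W_k\right),$$ where $W_i=P_{A_i\cap E}(x^* )$, unless $P_{A_i\cap E}(x^* )=0$, in which case $W_i=P_{A_i\cap F}(w_\tau)$, the projection of $w_\tau$ on $\mathbb{R}(A_i)$.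
   Context: Orthant spaces. Let $U=(u_1,\dots,u_M)$ be the standard orthonormal basis of $\mathbb{R}^M$; its elements are called axes. For $E\subseteq U$, $\mathbb{R}(E)$ is the span of $E$ and $\mathcal{O}(E)=\{\sum_{e\in E}\lambda_e e:\lambda_e>0\}$ is an open positive orthant ($\mathcal{O}(\emptyset)=\{o\}$, $o$ the origin). An orthant space $X^m$ of dimension $m\le M$ is a subspace of $\mathbb{R}^M$ that is a union of open positive orthants (its strata) of maximum dimension $m$, with the intrinsic (length) metric $d$ induced from the Euclidean metric, such that (i) for every orthant $\sigma$ in $X^m$ the orthants in its closure are also in $X^m$; (ii) if all the 2-dimensional orthants in the closure of a positive orthant $\sigma$ of $\mathbb{R}^M$ are in $X^m$ then $\sigma$ is in $X^m$. $X^m$ is a CAT(0)-space, so any two points are joined by a unique geodesic. $\mathcal{O}(E)$ bounds $\mathcal{O}(G)$ (and $\mathcal{O}(G)$ co-bounds $\mathcal{O}(E)$) if $E\subseteq G$; when writing $E\cup F$, $E$ and $F$ are disjoint (and in (ii) $F\ne\emptyset$). Carriers and supports. $E(x)$ is the set of axes along which $x\in X^m$ has positive coordinates. Sets $E,F\subseteq U$ are compatible if $\mathcal{O}(E\cup F)\subseteq X^m$. The carrier of the geodesic from $x_1$ to $x_2$ is the sequence $(\mathcal{O}_0,\dots,\mathcal{O}_k)$ of strata, in the order traversed, whose intersection with the geodesic is a line segment of positive length. Put $E(x_1,x_2)=(E(x_1)\cap E(x_2))\cup\{e\in E(x_1): e\text{ compatible with }E(x_2)\}\cup\{e\in E(x_2):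 e\text{ compatible with }E(x_1)\}$. The support of the geodesic is the pair $(\mathcal{A},\mathcal{B})$ of sequences with $A_0=B_0=E(x_1,x_2)$ and, for $i\ge1$, $A_i$ (resp. $B_i$) the set of all axes whose coordinates become zero (resp. positive) as the geodesic passes from $\mathcal{O}_{i-1}$ to $\mathcal{O}_i$; thus $\mathcal{O}_i=\mathcal{O}(A_0\cup B_1\cup\cdots\cup B_i\cup A_{i+1}\cup\cdots\cup A_k)$. If $x_1,x_2$ lie in the closure of a common orthant then $k=0$. Projections. $P_G(x)$ is the Euclidean orthogonal projection of $x$ onto $\mathbb{R}(G)$. $\jmath$ is the linear map positioning a list of coordinates indexed by a set of axes as the corresponding coordinates, with respect to $U$, of a vector of $\mathbb{R}^M$ (all other coordinates zero); in the displayed formula the coordinates are those along $A_0,A_1,\dots,A_k$ in turn, and $W_i$ is regarded as a vector in $\mathbb{R}(A_i)$. Logarithm map. For $x^*\in\sigma=\mathcal{O}(E)$ the tangent cone to $X^m$ at $x^*$ is the union of the sets $\mathbb{R}(E)\times\overline{\mathcal{O}(F)}$ over $F$ disjoint from $E$ with $\mathcal{O}(E\cup F)\subseteq X^m$, glued along common faces and regarded in $\mathbb{R}^M$. Vectors in $\mathbb{R}(E)$ are tangent to $\sigma$; vectors in $\mathbb{R}(E)\times\mathcal{O}(F)$ are tangent to $\tau=\mathcal{O}(E\cup F)$. Translated to the origin the tangent cone is denoted $C_\sigma$. $\log_{x^*}(x)$ is the initial (one-sided) tangent vector, of norm $d(x^*,x)$, of the geodesic from $x^*$ to $x$, and $\Phi(x;x^*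 )=\log_{x^*}(x)+x^*\in C_\sigma$ is the translated logarithm map. For a vector $w$ in the tangent cone at $x^*$, $x^*(\lambda,w)$ is the point at distance $\lambda\|w\|$ along the geodesic starting at $x^*$ with initial tangent vector $w$; for small $\lambda>0$ it is $x^*+\lambda w$. *)

(* Defs.v *)
(* MathComp-Analysis.  The axes u_1, ..., u_M are represented by their indices
   in 'I_M and points of R^M by row vectors.  The norm that the library puts on
   'rV[R]_M is the sup norm; it only serves for the topology, every length
   below being computed with the Euclidean norm [enorm]. *)
From HB Require Import structures.
From mathcomp Require Import all_boot all_order all_algebra.
From mathcomp Require Import all_classical all_reals all_analysis.

Set Implicit Arguments.
Unset Strict Implicit.
Unset Printing Implicit Defensive.

Import Order.TTheory GRing.Theory Num.Theory.
Import numFieldNormedType.Exports.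
Local Open Scope classical_set_scope.
Local Open Scope ring_scope.

Section Euclidean.
Variables (R : realType) (M : nat).
Implicit Types (E F G H : {set 'I_M}) (x y v w : 'rV[R]_M).

Definition enorm x : R := Num.sqrt (\sum_i x 0 i ^+ 2).

Definition coord_space E : set 'rV[R]_M :=
  [set x | forall i, i \notin E -> x 0 i = 0].

Definition orthant E : set 'rV[R]_M :=
  [set x | forall i, (i \in E -> 0 < x 0 i) /\ (i \notin E -> x 0 i = 0)].

Definition proj G x : 'rV[R]_M := \row_i (if i \in G then x 0 i else 0).

Definition pos_axes x : {set 'I_M} := finset (fun i => 0 < x 0 i).

(* The direct product R(E) x O(F), inside R^M. *)
Definition tangent_vectors E F : set 'rV[R]_M :=
  [set w | exists u v, [/\ coord_space E u, orthant F v & w = u + v]].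

(* The vector of R^M whose coordinates along A_0, A_1, ..., A_k are those of
   v_0, v_1, ..., v_k, the A_i being disjoint. *)
Definition jmath (A : seq {set 'I_M}) (v : nat -> 'rV[R]_M) : 'rV[R]_M :=
  \sum_(i < size A) proj (nth finset.set0 A i) (v i).

End Euclidean.

Section OrthantSpace.
Variables (R : realType) (M : nat).
Implicit Types (X : set 'rV[R]_M) (E F G H S : {set 'I_M}).
Implicit Types (x y xs w : 'rV[R]_M) (g : R -> 'rV[R]_M).

Definition stratum X G : Prop := orthant G `<=` X.

(* The premise of the last condition is vacuous for the orthants of dimension 0
   and 1: X contains the origin and all the axes. *)
Record orthant_space (m : nat) X : Prop := OrthantSpace {
  orthant_space_strata :
    exists K : set {set 'I_M}, X = \bigcup_(G in K) orthant G ;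
  orthant_space_dim :
    (exists2 G, stratum X G & #|G| = m) /\
    (forall G, stratum X G -> (#|G| <= m)%N) ;
  orthant_space_closed : forall G H,
    stratum X G -> @orthant R M H `<=` closure (orthant G) ->
    stratum X H ;
  orthant_space_flag : forall G,
    (forall H, #|H| = 2%N -> @orthant R M H `<=` closure (orthant G) ->
       stratum X H) ->
    stratum X G }.

Definition is_path X x y g : Prop :=
  [/\ {within `[0, 1], continuous g},
      (forall t, 0 <= t <= 1 -> X (g t)), g 0 = x & g 1 = y].

(* As for [variation] of real functions, [s] is the list of the nodes of a
   subdivision of [0, 1] other than 0. *)
Definition polygon_length g (s : seq R) : R :=
  let h := g \o nth 1 (0 :: s) in
  \sum_(0 <= n < size s) enorm (h n.+1 - h n).

Definition path_length g : \bar R :=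
  ereal_sup [set (polygon_length g s)%:E | s in itv_partition (0 : R) 1].

(* The intrinsic metric; the infimum is finite as any two points of an orthant
   space are joined by the two segments through the origin. *)
Definition dist X x y : R :=
  fine (ereal_inf [set path_length g | g in is_path X x y]).

(* Geodesics are parametrized by [0, 1], proportionally to arc length. *)
Definition is_geodesic X x y g : Prop :=
  [/\ (forall t, 0 <= t <= 1 -> X (g t)), g 0 = x, g 1 = y &
      forall s t, 0 <= s <= 1 -> 0 <= t <= 1 ->
        dist X (g s) (g t) = `|s - t| * dist X x y].

(* An orthant space is CAT(0), hence uniquely geodesic, so that the choice made
   here is immaterial on [0, 1]. *)
Definition geodesic X x y : R -> 'rV[R]_M :=
  xget (fun=> x) (is_geodesic X x y).

(* As the geodesic is parametrized by [0, 1], its initial velocity has norm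
   the distance from xs to x. *)
Definition log_map X xs x : 'rV[R]_M :=
  lim (t^-1 *: (geodesic X xs x t - xs) @[t --> 0^'+]).

(* Phi(x; xs) *)
Definition Phi X x xs : 'rV[R]_M := log_map X xs x + xs.

(* xs(lam, w): the end point of a geodesic of length lam |w| from xs with
   initial direction w.  For w in the tangent cone at xs and lam > 0 small, this
   characterizes the point xs + lam w; for large lam such a geodesic may fail to
   exist, or to be unique because geodesics can branch. *)
Definition geodesic_point X xs (lam : R) w : 'rV[R]_M :=
  xget xs [set y | [/\ X y, dist X xs y = lam * enorm w &
                       log_map X xs y = lam *: w]].

(* Psi(x, w; xs) *)
Definition Psi X x w xs : 'rV[R]_M :=
  lim (Phi X x (geodesic_point X xs lam w) @[lam --> 0^'+]).

Definition compatible X E F : Prop := stratum X (E :|: F).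

(* E(x1, x2) *)
Definition common_axes X x1 x2 : {set 'I_M} :=
  (pos_axes x1 :&: pos_axes x2)
  :|: finset (fun e => (e \in pos_axes x1) &&
                       `[< compatible X (finset.set1 e) (pos_axes x2) >])
  :|: finset (fun e => (e \in pos_axes x2) &&
                       `[< compatible X (finset.set1 e) (pos_axes x1) >]).

(* Meeting O(S) along a segment of positive length is expressed in terms of
   time.  This makes a difference only if x1 = x2, where the carrier is then
   the stratum of x1, so that k = 0 as for any two points in the closure of a
   common orthant. *)
Definition is_carrier X x1 x2 (s : seq {set 'I_M}) : Prop :=
  let g := geodesic X x1 x2 in
  (forall S, S \in s <->
     exists a b, [/\ 0 <= a, a < b, b <= 1 &
                     forall t, a < t < b -> orthant S (g t)]) /\
  (forall i j, (i < j < size s)%N ->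
     forall t u, 0 <= t <= 1 -> 0 <= u <= 1 ->
       orthant (nth finset.set0 s i) (g t) ->
       orthant (nth finset.set0 s j) (g u) -> t < u).

(* [(A, B)] is the support of the geodesic from x1 to x2; if the carrier is
   (O(S_0), ..., O(S_k)), the axes whose coordinates become zero on passing from
   O(S_(i-1)) to O(S_i) are those of S_(i-1) \ S_i, and likewise for B. *)
Definition is_support X x1 x2 (A B : seq {set 'I_M}) : Prop :=
  exists S0 s,
    [/\ is_carrier X x1 x2 (S0 :: s),
        A = common_axes X x1 x2 :: pairmap (fun S T => S :\: T) S0 s &
        B = common_axes X x1 x2 :: pairmap (fun S T => T :\: S) S0 s].

(* The vector W associated with the block of axes Ai. *)
Definition limit_direction E F xs w (Ai : {set 'I_M}) : 'rV[R]_M :=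
  if proj (Ai :&: E) xs == 0 then proj (Ai :&: F) w else proj (Ai :&: E) xs.

Definition limit_formula E F x xs w (A B : seq {set 'I_M}) : 'rV[R]_M :=
  jmath A (fun i =>
    let Bi := nth finset.set0 B i in
    let W := limit_direction E F xs w (nth finset.set0 A i) in
    if i == 0%N then proj Bi x else - (enorm (proj Bi x) / enorm W) *: W).

End OrthantSpace.

(* Main.v *)
Require Import Defs.
From HB Require Import structures.
From mathcomp Require Import all_boot all_order all_algebra.
From mathcomp Require Import all_classical all_reals all_analysis.
From mathcomp Require Import ring lra.
Set Implicit Arguments.
Unset Strict Implicit.
Unset Printing Implicit Defensive.
Import Order.TTheory GRing.Theory Num.Theory.
Import numFieldNormedType.Exports.
Local Open Scope classical_set_scope.
Local Open Scope ring_scope.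

(** Why the theorem is true.

    An orthant space is the set of nonnegative vectors whose positive axes are
    pairwise compatible, so a path in it is a path in the positive cone along
    which two clashing axes are never positive together.  Going from z to x,
    only the axes of z that clash with an axis of x (the set A) and the axes of
    x that clash with an axis of z (the set B) matter: each a in A has to die
    before each clashing b in B is born.  If tau prescribes the death times of
    the axes of A and the birth times of the axes of B, the natural path with
    these times moves every coordinate at constant velocity while it is active.
    Its energy is
      sum_A z_a^2 / tau_a + sum_B x_b^2 / (1 - tau_b) + sum_other (x_c - z_c)^2,
    a convex function of tau to be minimized under the order constraints
    tau_a <= tau_b.  This is an isotonic regression, so its solution has an
    explicit block structure: on a block of axes with weights P = sum of z_a^2
    and Q = sum of x_b^2, the common time is sqrt P / (sqrt P + sqrt Q).  The
    blocks are found by a finite greedy argument ([isotonic_blocks]).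

    The optimality conditions, collected in [schedule], say that the velocity field of the path calibrates it: for any
    competing path the field, switched on and off at that path's own death and
    birth times, has norm at most the speed D of the optimal path, while its
    integral along the competitor is D^2.  Cauchy-Schwarz gives that no path is
    shorter ([length_route_ge]), and the equality case gives that a geodesic
    coincides with the optimal path ([speed_lipschitz_route]).  Hence the
    intrinsic distances, the geodesics, their carriers and their initial
    velocities are all explicit ([dist_route], [geodesic_route],
    [log_map_velocity], [is_support_levels]).

    Along the segment xs + t w the weights P are polynomials in t, and a system
    of blocks is optimal when finitely many inequalities between products
    P(S) Q(T) hold.  A polynomial has a constant sign on some interval (0, e),
    so one and the same system of blocks is optimal there ([perturbed_blocks]):
    the support is constant.  The translated logarithm at xs + t w has the
    coordinate - z_a sqrt Q / sqrt P along an axis a of a block, and it remains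
    to let t tend to 0: if the block contains an axis of E, then z_a and sqrt P
    converge and the limit of P is positive; otherwise both are proportional to
    t and the quotient is constant ([cvg_unit_coord]).  If w is tangent to the
    stratum of xs, the optimality inequalities pass to the limit t = 0, so that
    the limit of the logarithms is the logarithm at xs ([limit_Phi_tangent]). *)

Local Notation proj := Defs.proj.

(** * Isotonic regression on a finite set *)

Section IsotonicBlocks.
Variables (R : realFieldType) (T : finType) (p q : T -> R).
Implicit Types (e : rel T) (I U D L : {set T}).

Definition mass (f : T -> R) (S : {set T}) : R := \sum_(i in S) f i.

(** The upper sets of I for e; the lower sets are the upper sets of the converse
    relation. *)
Definition closed_in e I U : bool :=
  (U \subset I) && [forall i in U, forall j in I, e i j ==> (j \in U)].

Lemma closed_inP e I U :
  reflect (U \subset I /\ forall i j, i \in U -> j \in I -> e i j -> j \in U)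
          (closed_in e I U).
Proof.
apply: (iffP andP) => -[sUI clU]; split=> //.
  move=> i j iU jI eij.
  by move/forall_inP: clU => /(_ i iU) /forall_inP /(_ j jI) /implyP; apply.
apply/forall_inP => i iU; apply/forall_inP => j jI; apply/implyP; exact: clU.
Qed.

Lemma massID f D S : mass f S = mass f (S :&: D) + mass f (S :\: D).
Proof. by rewrite /mass -finset.big_setID. Qed.

Lemma massU f D S : D :&: S = finset.set0 -> mass f (D :|: S) = mass f D + mass f S.
Proof.
move=> DS0; rewrite (massID f D) finset.setUK finset.setDUl finset.setDv finset.set0U.
by congr (_ + mass f _); apply/finset.setDidPl; rewrite -finset.setI_eq0 finset.setIC DS0.
Qed.

Lemma mass_ge0 f S : (forall i, 0 <= f i) -> 0 <= mass f S.
Proof. by move=> f0; apply: sumr_ge0. Qed.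

(** A greedy construction: a lower set D0 of least ratio p/q is taken, and
    then the largest lower set D1 of the same ratio, which exists because
    p - r q is modular and nonnegative on lower sets.  By maximality every lower
    set of the complement has a larger ratio, so the construction can be
    repeated there.  An upper part of D1 has a ratio at most r because the rest
    of D1 is a lower set.  The bound r0 is the ratio of the blocks already
    removed; it makes the ratios increase strictly from one block to the next. *)
Lemma isotonic_blocks e I (r0 : R) :
  (forall i, 0 <= q i) ->
  (forall D, closed_in (fun i j => e j i) I D -> D != finset.set0 ->
     r0 * mass q D < mass p D) ->
  (forall U, closed_in e I U -> U != finset.set0 -> 0 < mass q U) ->
  exists rho : T -> R,
    [/\ forall i, i \in I -> r0 < rho i,
        forall i j, i \in I -> j \in I -> e i j -> rho i <= rho j &
        forall i, i \in I -> let L := [set j in I | rho j == rho i] in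
          mass p L = rho i * mass q L /\
          forall U, closed_in e I U ->
            mass p (U :&: L) <= rho i * mass q (U :&: L)].
Proof.
move=> q0; have [n] := ubnP #|I|; elim: n I r0 => // n IHn I r0 In lowI upI.
have [I0|In0] := eqVneq I finset.set0.
  by exists (fun=> r0); rewrite I0; split=> [i|i j|i]; rewrite inE.
pose low D := closed_in (fun i j => e j i) I D.
have lowII : low I by apply/closed_inP; split.
have upII : closed_in e I I by apply/closed_inP; split.
pose ok D := low D && (0 < mass q D).
have okI : ok I by rewrite /ok lowII upI.
pose D0 := [arg min_(D < I | ok D) (mass p D / mass q D)]%O.
have [okD0 minD0] : ok D0 /\
    forall D, ok D -> mass p D0 / mass q D0 <= mass p D / mass q D.
  by rewrite /D0; case: Order.TotalTheory.arg_minP.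
set r := mass p D0 / mass q D0 in minD0.
have D0n0 : D0 != finset.set0.
  apply: contraTneq okD0 => ->; rewrite /ok negb_and.
  by rewrite /mass big_set0 ltxx orbT.
have /andP[lowD0 qD0] := okD0.
have rr0 : r0 < r by rewrite ltr_pdivlMr// lowI.
have pD0 : mass p D0 = r * mass q D0 by rewrite divfK// gt_eqF.
have h_ge0 D : low D -> r * mass q D <= mass p D.
  move=> lowD; have [->|Dn0] := eqVneq D finset.set0.
    by rewrite /mass !big_set0 mulr0.
  have [qD|] := ltP 0 (mass q D).
    by rewrite -ler_pdivlMr// minD0// /ok lowD.
  move=> qD; have qD00 : mass q D = 0 by apply/le_anti; rewrite qD mass_ge0.
  by have := lowI D lowD Dn0; rewrite qD00 !mulr0 => /ltW.
pose tight D := low D && (mass p D == r * mass q D).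
have tD0 : tight D0 by rewrite /tight lowD0 pD0 eqxx.
pose D1 := [arg max_(D > D0 | tight D) #|D|]%N.
have [/andP[lowD1 /eqP pD1] maxD1] : tight D1 /\
    forall D, tight D -> (#|D| <= #|D1|)%N.
  by rewrite /D1; case: arg_maxnP.
have [sD1I clD1] := closed_inP _ _ _ lowD1.
pose J := I :\: D1.
have JI : J \subset I by exact: subsetDl.
have D1n0 : (0 < #|D1|)%N.
  by rewrite (leq_trans _ (maxD1 _ tD0))// card_gt0.
have Jn : (#|J| < n)%N.
  rewrite -ltnS (leq_trans _ In)// ltnS -(cardsID D1 I) (finset.setIidPr sD1I) -/J.
  by rewrite -[X in (X < _)%N]add0n ltn_add2r.
have upJ U : closed_in e J U -> closed_in e I U.
  move=> /closed_inP[sUJ clU]; apply/closed_inP; split.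
    exact: fintype.subset_trans sUJ JI.
  move=> i j iU jI eij; apply: (clU i) => //.
  rewrite inE jI andbT; apply/negP => jD1.
  have /finset.setDP[iI /negP] := fintype.subsetP sUJ i iU; apply.
  exact: (clD1 j i).
have [|U upU|rho [rho_gt rho_mono rho_lev]] := IHn J r Jn.
- move=> D /closed_inP[sDJ clD] Dn0.
  have D1D : D1 :&: D = finset.set0.
    apply/eqP; rewrite finset.setI_eq0 disjoint_sym.
    by move: sDJ; rewrite /J finset.subsetD => /andP[].
  have lowU : low (D1 :|: D).
    apply/closed_inP; split.
      by rewrite finset.subUset sD1I (fintype.subset_trans sDJ).
    move=> i j; rewrite !inE => /orP[iD1|iD] jI eji.
      by rewrite (clD1 i j).
    have [//|jD1/=] := boolP (j \in D1).
    by apply: (clD i) => //; rewrite inE jD1.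
  have := h_ge0 _ lowU; rewrite !massU// mulrDr pD1 lerD2l le_eqVlt.
  case/orP => // /eqP pqD.
  have /maxD1 : tight (D1 :|: D) by rewrite /tight lowU !massU// mulrDr pD1 pqD/=.
  rewrite finset.cardsU D1D finset.cards0 subn0 -[X in (_ <= X)%N]addn0 leq_add2l leqn0.
  by rewrite cards_eq0 (negbTE Dn0).
- exact/upI/upJ.
pose rho' i := if i \in D1 then r else rho i.
have rho'D i : i \in D1 -> rho' i = r by rewrite /rho' => ->.
have rho'J i : i \in J -> rho' i = rho i.
  by rewrite /rho' inE => /andP[/negbTE -> _].
have IE i : i \in I -> (i \in D1) || (i \in J).
  by move=> iI; rewrite inE iI andbT orbN.
exists rho'; split.
- move=> i /IE/orP[iD|iJ]; first by rewrite rho'D.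
  by rewrite rho'J// (lt_trans rr0)// rho_gt.
- move=> i j /IE/orP[iD|iJ] /IE/orP[jD|jJ] eij.
  + by rewrite !rho'D.
  + by rewrite rho'D// rho'J// ltW// rho_gt.
  + have : i \in D1 by apply: (clD1 j i) => //; rewrite (fintype.subsetP JI).
    by move: iJ; rewrite inE => /andP[/negbTE ->].
  + by rewrite !rho'J// rho_mono.
move=> i /IE/orP[iD|iJ].
  have -> : [set j in I | rho' j == rho' i] = D1.
    apply/finset.setP => j; rewrite inE (rho'D i iD).
    apply/andP/idP => [[/IE/orP[//|jJ]]|jD1].
      by rewrite rho'J// gt_eqF// rho_gt.
    by rewrite (fintype.subsetP sD1I)// rho'D.
  rewrite rho'D//; split=> // U /closed_inP[sUI clU].
  have lowD : low (D1 :\: U).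
    apply/closed_inP; split; first by rewrite (fintype.subset_trans (subsetDl _ _)).
    move=> k j; rewrite !inE => /andP[kU kD1] jI ejk.
    rewrite (clD1 k j)// andbT; apply: contra kU => jU.
    by apply: (clU j) => //; rewrite (fintype.subsetP sD1I).
  have := h_ge0 _ lowD; have := pD1.
  rewrite (massID p U D1) (massID q U D1) mulrDr (finset.setIC D1 U); lra.
have -> : [set j in I | rho' j == rho' i] = [set j in J | rho j == rho i].
  apply/finset.setP => j; rewrite [LHS]inE [RHS]inE (rho'J i iJ).
  apply/andP/andP => [[/IE/orP[jD|jJ]]|[jJ]].
  - by rewrite rho'D// lt_eqF// rho_gt.
  - by rewrite rho'J.
  - by rewrite rho'J// (fintype.subsetP JI).
rewrite rho'J//; have [pL upL] := rho_lev i iJ; split=> // U /closed_inP[sUI clU].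
have -> : U :&: [set j in J | rho j == rho i] =
          (U :&: J) :&: [set j in J | rho j == rho i].
  apply/finset.setP => j; rewrite ![in RHS]inE ![in LHS]inE.
  by case: (j \in U); case: (j \in D1); case: (j \in I).
apply: upL; apply/closed_inP; split; first exact: subsetIr.
move=> k j; rewrite finset.in_setI => /andP[kU kJ] jJ ekj; rewrite finset.in_setI jJ andbT.
by apply: (clU k) => //; rewrite (fintype.subsetP JI).
Qed.

End IsotonicBlocks.

(** * Strata as cliques of compatible axes *)

Section Strata.
Variables (R : realType) (M m : nat) (X : set 'rV[R]_M).
Hypothesis hX : orthant_space m X.
Implicit Types (G H : {set 'I_M}) (x y z : 'rV[R]_M).

Lemma orthant_pos_axes G x : orthant G x -> pos_axes x = G.
Proof.
move=> Gx; apply/finset.setP => i; rewrite inE; have [h1 h2] := Gx i.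
by have [/h1//|/h2 ->] := boolP (i \in G); rewrite ltxx.
Qed.

Lemma cvg_lineE x v : (x + t *: v) @[t --> (0 : R)^'+] --> x.
Proof.
rewrite -[X in _ --> X]addr0 -(scale0r v).
by apply: cvgD; [exact: cvg_cst|apply: cvgZr_tmp; exact: cvg_at_right_filter].
Qed.

(** Pushing a point of the smaller orthant along the vector of ones on G gives
    points of the larger one that converge to it. *)
Lemma closure_orthantS G H : H \subset G ->
  @orthant R M H `<=` closure (orthant G).
Proof.
move=> sHG x Hx B nB.
have near0B := @cvg_lineE x (\row_i (i \in G)%:R) _ nB.
have [t [/= t0 Bt]] : exists t : R, 0 < t /\ B (x + t *: \row_i (i \in G)%:R).
  near (0 : R)^'+ => t; exists t; split; near: t => //.
  exact: nbhs_right_gt.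
exists (x + t *: \row_i (i \in G)%:R); split=> // i; rewrite !mxE.
have [h1 h2] := Hx i; split=> iG.
  rewrite iG mulr1 ltr_wpDl//.
  by have [/h1/ltW//|/h2 ->] := boolP (i \in H).
by rewrite (negbTE iG) mulr0 addr0 h2//; apply: contra iG; exact: (fintype.subsetP sHG).
Unshelve. all: by end_near. Qed.

Lemma closure_orthant_coord G : closure (@orthant R M G) `<=` coord_space G.
Proof.
move=> x clx i iG.
have cl0 : closed [set y : 'rV[R]_M | y 0 i = 0].
  apply: (@closed_comp _ _ (fun y : 'rV[R]_M => y 0 i) [set 0]).
    by move=> y _; exact: coord_continuous.
  exact: closed_eq.
apply: cl0; apply: closure_subset clx => y Gy /=.
by have [_ ->] := Gy i.
Qed.

Lemma orthantSP G H : @orthant R M H `<=` closure (orthant G) -> H \subset G.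
Proof.
move=> HG; apply/fintype.subsetP => i iH; apply/negPn/negP => iG.
pose y : 'rV[R]_M := \row_j (j \in H)%:R.
have /HG /closure_orthant_coord /(_ i iG) : orthant H y.
  by move=> j; rewrite mxE; split=> [->//|/negbTE ->].
by rewrite mxE iH => /eqP; rewrite oner_eq0.
Qed.

(** For i = j the set is a singleton, and every axis of an orthant space is a
    stratum, so that an axis never clashes with itself. *)
Definition clash (i j : 'I_M) : bool := ~~ `[< stratum X [set i; j]%SET >].

Lemma clashC i j : clash i j = clash j i.
Proof. by rewrite /clash finset.setUC. Qed.

Lemma stratum_sub G H : stratum X G -> H \subset G -> stratum X H.
Proof.
by move=> XG sHG; apply: (orthant_space_closed hX XG); exact: closure_orthantS.
Qed.

(** The flag condition on the orthant space, with the closures translated into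
    inclusions of sets of axes. *)
Lemma stratumP G :
  stratum X G <-> forall i j, i \in G -> j \in G -> ~~ clash i j.
Proof.
split=> [XG i j iG jG|noclash].
  rewrite negbK; apply/asboolP; apply: (stratum_sub XG).
  by rewrite finset.subUset !finset.sub1set iG jG.
apply: (orthant_space_flag hX) => H H2 /orthantSP sHG.
have /cards2P[i [j [ij HE]]] : #|H| == 2%N by rewrite H2.
have := noclash i j; rewrite negbK => h; rewrite HE; apply/asboolP; apply: h.
  by apply: (fintype.subsetP sHG); rewrite HE !inE eqxx.
by apply: (fintype.subsetP sHG); rewrite HE !inE eqxx orbT.
Qed.

Lemma mem_stratum x : X x -> orthant (pos_axes x) x /\ stratum X (pos_axes x).
Proof.
have [K XE] := orthant_space_strata hX; rewrite XE => -[G KG Gx].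
rewrite (orthant_pos_axes Gx); split=> // y Gy.
by exists G.
Qed.

Lemma coord_ge0 x i : X x -> 0 <= x 0 i.
Proof.
move=> /mem_stratum[/(_ i)[h1 h2] _].
by have [/h1/ltW//|/h2 ->] := boolP (i \in pos_axes x).
Qed.

Lemma coord_noclash x i j : X x -> 0 < x 0 i -> 0 < x 0 j -> ~~ clash i j.
Proof.
move=> /mem_stratum[_ /stratumP nc] xi xj.
by apply: nc; rewrite inE.
Qed.

(** Together with [coord_ge0] and [coord_noclash], this replaces the orthant
    space by a set of inequalities on coordinates. *)
Lemma mem_orthant_space x : (forall i, 0 <= x 0 i) ->
  (forall i j, 0 < x 0 i -> 0 < x 0 j -> ~~ clash i j) -> X x.
Proof.
move=> x0 nc.
have /stratumP : forall i j, i \in pos_axes x -> j \in pos_axes x -> ~~ clash i j.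
  by move=> i j; rewrite !inE; exact: nc.
apply => i; rewrite inE; split=> //.
by rewrite -leNgt => xi; apply/le_anti; rewrite xi x0.
Qed.

End Strata.

(** * Euclidean norm, hitting times and subdivisions *)

Section EuclideanNorm.
Variables (R : realType) (M : nat).
Implicit Types (a b x y : 'rV[R]_M) (g : R -> 'rV[R]_M).

Lemma enorm_ge0 x : 0 <= enorm x.
Proof. exact: sqrtr_ge0. Qed.

Lemma enorm_sqr x : enorm x ^+ 2 = \sum_i x 0 i ^+ 2.
Proof. by rewrite sqr_sqrtr// sumr_ge0// => i _; exact: sqr_ge0. Qed.

Lemma enorm_le x (D : R) : 0 <= D -> (\sum_i x 0 i ^+ 2 <= D ^+ 2) -> enorm x <= D.
Proof.
by move=> D0 h; rewrite -(@ler_pXn2r _ 2)// ?nnegrE ?enorm_ge0// enorm_sqr.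
Qed.

Lemma coord_le_enorm x i : `|x 0 i| <= enorm x.
Proof.
rewrite -sqrtr_sqr ler_wsqrtr// (bigD1 i)//= lerDl sumr_ge0// => j _.
exact: sqr_ge0.
Qed.

Lemma enormZ (c : R) x : enorm (c *: x) = `|c| * enorm x.
Proof.
rewrite /enorm -sqrtr_sqr -sqrtrM ?sqr_ge0// mulr_sumr; congr Num.sqrt.
by apply: eq_bigr => i _; rewrite mxE exprMn.
Qed.

(** Cauchy-Schwarz, read off from the squared norm of D a - |a| b. *)
Lemma dot_le a (b : 'I_M -> R) (D : R) : 0 <= D -> \sum_i b i ^+ 2 <= D ^+ 2 ->
  \sum_i a 0 i * b i <= D * enorm a.
Proof.
move=> D0 bD; set s := \sum_i a 0 i * b i; set N := enorm a.
have N0 : 0 <= N by exact: enorm_ge0.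
have : 0 <= \sum_i (D * a 0 i - N * b i) ^+ 2.
  by apply: sumr_ge0 => i _; exact: sqr_ge0.
have -> : \sum_i (D * a 0 i - N * b i) ^+ 2 =
    D ^+ 2 * N ^+ 2 - 2 * D * N * s + N ^+ 2 * \sum_i b i ^+ 2.
  have -> : N ^+ 2 = \sum_i a 0 i ^+ 2 by exact: enorm_sqr.
  rewrite [D ^+ 2 * _]mulr_sumr [2 * D * N * s]mulr_sumr.
  rewrite -(enorm_sqr a) -/N [N ^+ 2 * _]mulr_sumr -sumrB -big_split/=.
  by apply: eq_bigr => i _; ring.
move=> h.
have {}h : 0 <= D * N * (D * N - s).
  have : N ^+ 2 * \sum_i b i ^+ 2 <= N ^+ 2 * D ^+ 2 by rewrite ler_wpM2l ?sqr_ge0.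
  nra.
have [DN0|DN0] := ltP 0 (D * N); first by rewrite pmulr_rge0// subr_ge0 in h.
have {}DN0 : D * N = 0 by apply/le_anti; rewrite DN0 mulr_ge0.
rewrite DN0; have [D00|Dn0] := eqVneq D 0.
  have b0 i : b i = 0.
    apply/eqP; rewrite -sqrf_eq0; apply: contraT => bi.
    have : \sum_i b i ^+ 2 <= 0 by move: bD; rewrite D00 expr0n.
    rewrite leNgt (bigD1 i)//= ltr_wpDr ?lt_def ?bi ?sqr_ge0//.
    by rewrite sumr_ge0// => j _; exact: sqr_ge0.
  by rewrite /s big1// => i _; rewrite b0 mulr0.
rewrite /s big1// => i _.
have /eqP : N == 0 by move/eqP: DN0; rewrite mulf_eq0 (negbTE Dn0).
move=> N00; have := coord_le_enorm a i; rewrite -/N N00 normr_le0 => /eqP ->.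
by rewrite mul0r.
Qed.

Lemma lipschitz_continuous g (K : R) :
  (forall s t, 0 <= s <= 1 -> 0 <= t <= 1 -> enorm (g t - g s) <= K * `|t - s|) ->
  {within `[0, 1], continuous g}.
Proof.
move=> gK; rewrite continuous_subspace_in => s; rewrite inE/= in_itv/= => s01.
have sin : `[0, 1]%classic s by rewrite /= in_itv.
move=> B /nbhs_ballP[e /= e0 eB].
change (nbhs_subspace (A := `[0 : R, 1]%classic : set R) s (g @^-1` B)).
rewrite -nbhs_subspace_in//.
have K0 : 0 < `|K| + 1 by rewrite ltr_wpDl.
have d0 : 0 < e / (`|K| + 1) by rewrite divr_gt0.
apply/nbhs_ballP; exists (e / (`|K| + 1)) => // t; rewrite /ball/= => st tin.
apply: eB; split=> // i j.
have t01 : 0 <= t <= 1 by move: tin; rewrite /= in_itv.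
rewrite ord1 /ball/= distrC.
have -> : g t 0 j - g s 0 j = (g t - g s) 0 j by rewrite !mxE.
apply: (le_lt_trans (coord_le_enorm _ _)).
apply: (le_lt_trans (gK _ _ s01 t01)).
apply: (@le_lt_trans _ _ ((`|K| + 1) * `|t - s|)).
  by rewrite ler_wpM2r// (le_trans (ler_norm K))// lerDl.
by rewrite mulrC -ltr_pdivlMr// distrC.
Qed.

Lemma within_coord g i : {within `[0, 1], continuous g} ->
  {within `[0, 1], continuous (fun t => g t 0 i)}.
Proof.
move=> cg t.
exact: (cvg_comp _ _ (cg t) (@coord_continuous R 1 M 0 i (g t))).
Qed.

End EuclideanNorm.

Section Hitting.
Variables (R : realType) (f : R -> R) (c : R).
Hypothesis cf : {within `[0, 1], continuous f}.

Lemma neq_near k : 0 <= k <= 1 -> f k != c ->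
  exists2 e, 0 < e & forall u, 0 <= u <= 1 -> `|u - k| < e -> f u != c.
Proof.
move=> k01 fkc.
have kin : `[0, 1]%classic k by rewrite /= in_itv.
have d0 : 0 < `|f k - c| by rewrite normr_gt0 subr_eq0.
have : nbhs_subspace (A := `[0 : R, 1]%classic : set R) k (f @^-1` ball (f k) `|f k - c|).
  exact: (cf (nbhsx_ballx (f k) _ d0)).
rewrite -nbhs_subspace_in// => -[e /= e0 eB]; exists e => // u u01 uke.
have /eB : ball k e u by rewrite /ball/= distrC.
move=> /(_ _)/=; rewrite in_itv/= => /(_ u01).
rewrite /ball/=; apply: contraTneq => ->; by rewrite ltxx.
Qed.

Lemma first_hit u0 : 0 <= u0 <= 1 -> f u0 = c ->
  exists k, [/\ 0 <= k <= 1, f k = c &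
    forall u, 0 <= u <= 1 -> f u = c -> k <= u].
Proof.
move=> u01 fu0; pose S := [set u | 0 <= u <= 1 /\ f u = c].
have Sinf : has_inf S.
  by split; [exists u0|exists 0 => u [/andP[]]].
have Slb u : S u -> inf S <= u by move=> Su; apply: ge_inf => //; case: Sinf.
exists (inf S).
have k01 : 0 <= inf S <= 1.
  rewrite lb_le_inf//=; [|exact: Sinf.1|by move=> u [/andP[]]].
  by rewrite (le_trans (Slb u0 _))//; case/andP: u01.
split=> //; last by move=> u ? ?; apply: Slb.
apply/eqP/negPn/negP => /(neq_near k01)[e e0 he].
have [u [u1 fu] ule] := inf_adherent e0 Sinf.
suff : f u != c by rewrite fu eqxx.
by apply: he => //; rewrite ger0_norm ?subr_ge0 ?Slb// ltrBlDl.
Qed.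

Lemma last_hit u0 : 0 <= u0 <= 1 -> f u0 = c ->
  exists k, [/\ 0 <= k <= 1, f k = c &
    forall u, 0 <= u <= 1 -> f u = c -> u <= k].
Proof.
move=> u01 fu0; pose S := [set u | 0 <= u <= 1 /\ f u = c].
have Ssup : has_sup S.
  by split; [exists u0|exists 1 => u [/andP[]]].
have Sub u : S u -> u <= sup S by move=> Su; apply: ub_le_sup => //; case: Ssup.
exists (sup S).
have k01 : 0 <= sup S <= 1.
  rewrite ge_sup ?andbT//; [|exact: Ssup.1|by move=> u [/andP[]]].
  by rewrite (le_trans _ (Sub u0 _))//; case/andP: u01.
split=> //; last by move=> u ? ?; apply: Sub.
apply/eqP/negPn/negP => /(neq_near k01)[e e0 he].
have [u [u1 fu] ule] := sup_adherent e0 Ssup.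
suff : f u != c by rewrite fu eqxx.
by apply: he => //; rewrite distrC ger0_norm ?subr_ge0 ?Sub// ltrBlDr -ltrBlDl.
Qed.

End Hitting.

Section Subdivisions.
Variable R : realType.

(** A sum over the steps of a subdivision that passes through the switching
    times of the axes sees each axis either active or inactive during a whole
    step. *)
Lemma subdivision_through (l : seq R) : (forall x, x \in l -> 0 <= x <= 1) ->
  exists2 s, itv_partition (0 : R) 1 s & forall x, x \in l -> x \in 0 :: s.
Proof.
move=> l01; pose s := sort <=%R (undup [seq y <- 1 :: l | 0 < y]).
have sE x : (x \in s) = (0 < x) && (x \in 1 :: l).
  by rewrite mem_sort mem_undup mem_filter.
have s01 x : x \in s -> 0 < x <= 1.
  rewrite sE inE => /andP[-> /orP[/eqP ->|/l01/andP[_ ->//]]].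
  by rewrite lexx.
have ssort : sorted <%R s by rewrite sort_lt_sorted undup_uniq.
have path0 : path <%R 0 s.
  rewrite (path_sortedE lt_trans) ssort andbT; apply/allP => x /s01/andP[]//.
exists s; first split=> //.
- have s1 : 1 \in s by rewrite sE ltr01 inE eqxx.
  have : last 0 s \in s by case: (s) s1 => //= a t _; exact: mem_last.
  move=> /s01 /andP[_ l1]; rewrite eq_le l1/=.
  have sle : sorted <=%R s by apply: sub_sorted ssort => a b /ltW.
  have /(nthP 0)[n ns <-] := s1; rewrite -nth_last.
  have s0 : (0 < size s)%N by exact: leq_ltn_trans ns.
  apply: (sorted_leq_nth le_trans lexx 0 sle); rewrite ?inE ?prednK//.
  by rewrite -ltnS prednK.
- move=> x xl; rewrite inE sE inE xl orbT andbT.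
  by have /andP[+ _] := l01 x xl; rewrite le_eqVlt eq_sym.
Qed.

Variable s : seq R.
Hypothesis ps : itv_partition (0 : R) 1 s.
Let T := nth 1 (0 :: s).

Lemma subdivision_lt n : (n < size s)%N -> T n < T n.+1.
Proof.
move=> ns; have [ps1 _] := ps.
have /(_ n) := (pathP 1 ps1); exact.
Qed.

Lemma subdivision_last : T (size s) = 1.
Proof.
have [_ /eqP l1] := ps.
by rewrite /T -[in LHS]last_nth.
Qed.

Lemma subdivision_mono m n : (m <= n <= size s)%N -> T m <= T n.
Proof.
case/andP; elim: n => [|n IHn]; first by rewrite leqn0 => /eqP ->.
rewrite leq_eqVlt ltnS => /orP[/eqP ->//|mn] ns.
by rewrite (le_trans (IHn mn (ltnW ns)))// ltW// subdivision_lt.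
Qed.

Lemma subdivision01 n : (n <= size s)%N -> 0 <= T n <= 1.
Proof.
move=> ns; apply/andP; split; first exact: (@subdivision_mono 0).
by rewrite -subdivision_last subdivision_mono// ns leqnn.
Qed.

Lemma subdivision_through_step x n : x \in 0 :: s -> (n < size s)%N ->
  (x <= T n) || (T n.+1 <= x).
Proof.
move=> /(nthP 1)[k ks <-] ns; rewrite ltnS in ks.
by have [kn|nk] := leqP k n; apply/orP; [left|right]; rewrite subdivision_mono ?kn ?nk// ltnW.
Qed.

End Subdivisions.

(** * Schedules and the routes that they define *)

Section Itineraries.
Variables (R : realType) (M m : nat) (X : set 'rV[R]_M).
Hypothesis hX : orthant_space m X.
Implicit Types (x y z : 'rV[R]_M) (tau kappa : 'I_M -> R) (i j : 'I_M).

(** The axes of z that have to vanish on the way to x, before the axes of x with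
    which they clash appear.  The axes of x that have to wait for them are
    [obstructed x z]. *)
Definition obstructed z x : {set 'I_M} :=
  [set i | (0 < z 0 i) && [exists j, (0 < x 0 j) && clash X i j]]%SET.

Definition velocity z x tau i : R :=
  if i \in obstructed z x then - (z 0 i / tau i)
  else if i \in obstructed x z then x 0 i / (1 - tau i)
  else x 0 i - z 0 i.

(** The time during which the axis i has been active up to the time t, when the
    axes of [obstructed z x] stop at the times kappa and those of
    [obstructed x z] start at these times. *)
Definition clock z x kappa (t : R) i : R :=
  if i \in obstructed z x then Num.min t (kappa i)
  else if i \in obstructed x z then t - Num.min t (kappa i)
  else t.

Definition active z x kappa (t : R) i : bool :=
  if i \in obstructed z x then t < kappa i
  else if i \in obstructed x z then kappa i <= t
  else true.

Definition route z x tau (t : R) : 'rV[R]_M :=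
  \row_i (z 0 i + velocity z x tau i * clock z x tau t i).

Definition order_respecting z x kappa : Prop :=
  forall i j, i \in obstructed z x -> j \in obstructed x z -> clash X i j ->
    kappa i <= kappa j.

(** Optimality of the times tau.  The squared velocities are, up to sign, the
    derivatives of the energy with respect to the times.  [schedule_balance] says
    that they compensate on each level set of tau (h can be supported on one
    level), and [schedule_upper] that delaying an upper set of axes does not
    decrease the energy to first order. *)
Record schedule z x tau : Prop := Schedule {
  schedule01 : forall i, i \in obstructed z x :|: obstructed x z -> 0 < tau i < 1;
  schedule_order : order_respecting z x tau;
  schedule_balance : forall h : R -> R,
    \sum_(i in obstructed z x) velocity z x tau i ^+ 2 * h (tau i) =
    \sum_(i in obstructed x z) velocity z x tau i ^+ 2 * h (tau i);
  schedule_upper : forall U : {set 'I_M},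
    (forall i j, i \in obstructed z x -> j \in obstructed x z -> clash X i j ->
       i \in U -> j \in U) ->
    \sum_(i in obstructed z x | i \in U) velocity z x tau i ^+ 2 <=
    \sum_(i in obstructed x z | i \in U) velocity z x tau i ^+ 2 }.

(** By [schedule_balance] the squared velocity of the route is the same
    between any two switching times; this is its value near the time 1, when the axes of [obstructed z x]
    have vanished and all the others are moving. *)
Definition speed z x tau : R :=
  Num.sqrt (\sum_(i | i \notin obstructed z x) velocity z x tau i ^+ 2).

Lemma obstructed_gt0 z x i : i \in obstructed z x -> 0 < z 0 i.
Proof. by rewrite inE => /andP[]. Qed.

Lemma obstructed0 z x i : X x -> i \in obstructed z x -> x 0 i = 0.
Proof.
move=> hx; rewrite inE => /andP[_ /existsP[j /andP[xj cij]]].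
apply/le_anti; rewrite (coord_ge0 hX)// andbT leNgt; apply/negP => xi.
by have := coord_noclash hX hx xi xj; rewrite cij.
Qed.

Lemma obstructed_disj z x i : X x -> i \in obstructed z x ->
  i \notin obstructed x z.
Proof.
move=> hx iA; apply/negP => /obstructed_gt0.
by rewrite (obstructed0 hx iA) ltxx.
Qed.

Lemma obstructedP z x i : i \in obstructed z x ->
  exists2 j, j \in obstructed x z & clash X i j.
Proof.
rewrite inE => /andP[zi /existsP[j /andP[xj cij]]]; exists j => //.
by rewrite inE xj/=; apply/existsP; exists i; rewrite zi clashC.
Qed.

Lemma clash_obstructed z x i j : 0 < z 0 i -> 0 < x 0 j -> clash X i j ->
  i \in obstructed z x /\ j \in obstructed x z.
Proof.
move=> zi xj cij; split; rewrite inE ?zi ?xj/=; apply/existsP.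
  by exists j; rewrite xj.
by exists i; rewrite zi clashC.
Qed.

Section Clock.
Variables (z x : 'rV[R]_M) (kappa : 'I_M -> R).

Lemma clock_incr u v i : u <= v ->
  0 <= clock z x kappa v i - clock z x kappa u i <= v - u.
Proof.
move=> uv; rewrite /clock; case: ifP => _; last case: ifP => _.
- by case: (leP v (kappa i)); case: (leP u (kappa i)); lra.
- by case: (leP v (kappa i)); case: (leP u (kappa i)); lra.
- lra.
Qed.

Lemma clock_step u v i : u < v ->
  (i \in obstructed z x :|: obstructed x z ->
     (kappa i <= u) || (v <= kappa i)) ->
  clock z x kappa v i - clock z x kappa u i =
  (v - u) * (active z x kappa u i)%:R.
Proof.
move=> uv; rewrite finset.in_setU /clock /active.
case: ifP => _ /=; last case: ifP => _ /=.
- move=> /(_ isT) ku; case: ltP => h; rewrite ?mulr1 ?mulr0.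
    by case: (leP v (kappa i)) ku => ?; case: (leP u (kappa i)); lra.
  by case: (leP v (kappa i)) ku => ?; case: (leP u (kappa i)); lra.
- move=> /(_ isT) ku; case: leP => h; rewrite ?mulr1 ?mulr0.
    by case: (leP v (kappa i)) ku => ?; case: (leP u (kappa i)); lra.
  by case: (leP v (kappa i)) ku => ?; case: (leP u (kappa i)); lra.
- by rewrite mulr1.
Qed.

End Clock.

Section Schedule.
Variables (z x : 'rV[R]_M) (tau : 'I_M -> R).
Hypotheses (hz : X z) (hx : X x) (htau : schedule z x tau).
Local Notation A := (obstructed z x).
Local Notation B := (obstructed x z).
Local Notation vel := (velocity z x tau).
Local Notation D := (speed z x tau).

Lemma velocityA i : i \in A -> vel i = - (z 0 i / tau i).
Proof. by rewrite /velocity => ->. Qed.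

Lemma velocityB i : i \in B -> vel i = x 0 i / (1 - tau i).
Proof. by move=> iB; rewrite /velocity iB (negbTE (obstructed_disj hz iB)). Qed.

Lemma clockB kappa t i : i \in B -> clock z x kappa t i = t - Num.min t (kappa i).
Proof. by move=> iB; rewrite /clock iB (negbTE (obstructed_disj hz iB)). Qed.

Lemma schedule01A i : i \in A -> 0 < tau i < 1.
Proof. by move=> iA; apply: (schedule01 htau); rewrite finset.in_setU iA. Qed.

Lemma schedule01B i : i \in B -> 0 < tau i < 1.
Proof. by move=> iA; apply: (schedule01 htau); rewrite finset.in_setU iA orbT. Qed.

Lemma velocityA_lt0 i : i \in A -> vel i < 0.
Proof.
move=> iA; rewrite velocityA// oppr_lt0 divr_gt0 ?(obstructed_gt0 iA)//.
by case/andP: (schedule01A iA).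
Qed.

Lemma velocityB_gt0 i : i \in B -> 0 < vel i.
Proof.
move=> iB; rewrite velocityB// divr_gt0 ?(obstructed_gt0 iB)// subr_gt0.
by case/andP: (schedule01B iB).
Qed.

Lemma routeA t i : i \in A -> route z x tau t 0 i = - vel i * (tau i - Num.min t (tau i)).
Proof.
move=> iA; have /andP[t0 _] := schedule01A iA.
rewrite mxE velocityA// /clock iA; field; exact/lt0r_neq0.
Qed.

Lemma routeB t i : i \in B -> route z x tau t 0 i = vel i * (t - Num.min t (tau i)).
Proof. by move=> iB; rewrite mxE clockB// (obstructed0 hz iB) add0r. Qed.

Lemma route_other t i : i \notin A -> i \notin B ->
  route z x tau t 0 i = (1 - t) * z 0 i + t * x 0 i.
Proof.
move=> /negbTE iA /negbTE iB; rewrite mxE /velocity /clock iA iB; ring.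
Qed.

Lemma routeA_gt0 t i : i \in A -> (0 < route z x tau t 0 i) = (t < tau i).
Proof.
move=> iA; rewrite routeA// pmulr_rgt0 ?oppr_gt0 ?velocityA_lt0// subr_gt0.
by rewrite gt_min ltxx orbF.
Qed.

Lemma routeB_gt0 t i : i \in B -> (0 < route z x tau t 0 i) = (tau i < t).
Proof.
move=> iB; rewrite routeB// pmulr_rgt0 ?velocityB_gt0// subr_gt0.
by rewrite gt_min ltxx.
Qed.

Lemma routeA_eq0 t i : i \in A -> tau i <= t -> route z x tau t 0 i = 0.
Proof. by move=> iA h; rewrite routeA// min_r// subrr mulr0. Qed.

Lemma routeB_eq0 t i : i \in B -> t <= tau i -> route z x tau t 0 i = 0.
Proof. by move=> iB h; rewrite routeB// min_l// subrr mulr0. Qed.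

Lemma route0 : route z x tau 0 = z.
Proof.
apply/rowP => i; have [iA|iA] := boolP (i \in A).
  have /andP[t0 _] := schedule01A iA.
  rewrite routeA// min_l ?ltW// subr0 velocityA// opprK divfK//; exact: lt0r_neq0.
have [iB|iB] := boolP (i \in B).
  have /andP[t0 _] := schedule01B iB.
  by rewrite routeB// min_l ?ltW// subrr mulr0 (obstructed0 hz iB).
by rewrite route_other// subr0 mul1r mul0r addr0.
Qed.

Lemma route1 : route z x tau 1 = x.
Proof.
apply/rowP => i; have [iA|iA] := boolP (i \in A).
  have /andP[_ t1] := schedule01A iA.
  by rewrite routeA// min_r ?ltW// subrr mulr0 (obstructed0 hx iA).
have [iB|iB] := boolP (i \in B).
  have /andP[_ t1] := schedule01B iB.
  by rewrite routeB// min_r ?ltW// velocityB// divfK// gt_eqF// subr_gt0.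
by rewrite route_other// subrr mul1r mul0r add0r.
Qed.

Lemma route_in t : 0 <= t <= 1 -> X (route z x tau t).
Proof.
move=> /andP[t0 t1]; apply: (mem_orthant_space hX) => [i|i j].
  have [iA|iA] := boolP (i \in A).
    by rewrite routeA// mulr_ge0 ?subr_ge0 ?ge_min ?lexx ?orbT// oppr_ge0 ltW// velocityA_lt0.
  have [iB|iB] := boolP (i \in B).
    by rewrite routeB// mulr_ge0 ?subr_ge0 ?ge_min ?lexx// ltW// velocityB_gt0.
  by rewrite route_other// addr_ge0// mulr_ge0 ?(coord_ge0 hX)// subr_ge0.
have pos k : 0 < route z x tau t 0 k -> 0 < z 0 k \/ 0 < x 0 k.
  have [zk|zk] := ltP 0 (z 0 k); first by left.
  have [xk|xk] := ltP 0 (x 0 k); first by right.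
  have kA : k \notin A by apply: contraTN zk => /obstructed_gt0; rewrite ltNge.
  have kB : k \notin B by apply: contraTN xk => /obstructed_gt0; rewrite ltNge.
  rewrite route_other// => zx0; exfalso; nra.
wlog : i j / 0 < z 0 i.
  move=> wl iP jP; have [zi|xi] := pos i iP; first exact: wl.
  have [zj|xj] := pos j jP; first by rewrite clashC; apply: wl.
  exact: (coord_noclash hX hx).
move=> zi iP jP; have [zj|xj] := pos j jP; first exact: (coord_noclash hX hz).
apply/negP => cij; have [iA jB] := clash_obstructed zi xj cij.
have := schedule_order htau iA jB cij.
move: iP jP; rewrite routeA_gt0// routeB_gt0// => h1 h2.
by rewrite leNgt (lt_trans h2 h1).
Qed.

Lemma sum_split_axes (f : 'I_M -> R) : \sum_i f i =
  \sum_(i in A) f i + (\sum_(i in B) f i + \sum_(i | (i \notin A) && (i \notin B)) f i).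
Proof.
rewrite (bigID (mem A))/=; congr (_ + _).
rewrite (bigID (mem B))/=; congr (_ + _); apply: eq_bigl => i.
by have [/(obstructed_disj hz)|] := boolP (i \in B); rewrite ?andbT ?andbF.
Qed.

Lemma speed_ge0 : 0 <= D.
Proof. exact: sqrtr_ge0. Qed.

Lemma speed_sqr : D ^+ 2 =
  \sum_(i in B) vel i ^+ 2 + \sum_(i | (i \notin A) && (i \notin B)) vel i ^+ 2.
Proof.
rewrite sqr_sqrtr ?sumr_ge0// => [|i _]; last exact: sqr_ge0.
rewrite (bigID (mem B))/=; congr (_ + _); apply: eq_bigl => i.
by have [/(obstructed_disj hz)|] := boolP (i \in B); rewrite ?andbT ?andbF.
Qed.

(** On a level of tau the squared velocities of the axes that vanish have the
    same sum as those of the axes that appear, and the two clocks add up to t. *)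
Lemma clock_energy t : \sum_i vel i ^+ 2 * clock z x tau t i = t * D ^+ 2.
Proof.
rewrite sum_split_axes speed_sqr.
have -> : \sum_(i in A) vel i ^+ 2 * clock z x tau t i =
          \sum_(i in A) vel i ^+ 2 * Num.min t (tau i).
  by apply: eq_bigr => i iA; rewrite /clock iA.
rewrite (schedule_balance htau (Num.min t)) addrA -big_split/= mulrDr !mulr_sumr.
congr (_ + _); apply: eq_bigr => i.
  by move=> iB; rewrite clockB//; ring.
by move=> /andP[/negbTE iA /negbTE iB]; rewrite /clock iA iB mulrC.
Qed.

(** For any admissible switching times, optimal or not, the axes whose time is
    still to come form an upper set.  On it the squared velocity of the vanishing
    axes, which are moving, is at most that of the appearing ones, which are at
    rest. *)
Lemma active_energy kappa t : order_respecting z x kappa ->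
  \sum_i (vel i * (active z x kappa t i)%:R) ^+ 2 <= D ^+ 2.
Proof.
move=> hk; rewrite sum_split_axes speed_sqr addrA lerD//; last first.
  apply: ler_sum => i /andP[/negbTE iA /negbTE iB].
  by rewrite /active iA iB mulr1.
pose U := [set i | t < kappa i]%SET.
have E (C : {set 'I_M}) : \sum_(i in C | i \in U) vel i ^+ 2 =
    \sum_(i in C) vel i ^+ 2 * (i \in U)%:R.
  rewrite big_mkcondr/=; apply: eq_bigr => i _.
  by case: (i \in U); rewrite ?mulr1 ?mulr0.
have := @schedule_upper _ _ _ htau U _; rewrite !E => UA.
have {UA}: \sum_(i in A) vel i ^+ 2 * (i \in U)%:R <=
           \sum_(i in B) vel i ^+ 2 * (i \in U)%:R.
  apply: UA => i j iA jB cij; rewrite !inE => /lt_le_trans; apply.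
  exact: hk.
have -> : \sum_(i in A) vel i ^+ 2 * (i \in U)%:R =
          \sum_(i in A) (vel i * (active z x kappa t i)%:R) ^+ 2.
  apply: eq_bigr => i iA; rewrite /active iA inE exprMn.
  by case: (_ < _); rewrite ?expr1n ?expr0n.
move=> h; rewrite -lerBrDr; apply: (le_trans h); rewrite lerBrDr -big_split/=.
apply: ler_sum => i iB; rewrite /active iB (negbTE (obstructed_disj hz iB)) inE [kappa i <= t]leNgt.
by case: (t < kappa i); rewrite ?mulr1 ?mulr0 ?expr0n ?addr0 ?add0r.
Qed.

(** A clock increment c over a time t - s satisfies c^2 <= (t - s) c, and the
    increments, weighted by the squared velocities, sum up to (t - s) D^2. *)
Lemma route_lipschitz s t :
  enorm (route z x tau t - route z x tau s) <= D * `|t - s|.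
Proof.
have sym u v : enorm (route z x tau u - route z x tau v) =
               enorm (route z x tau v - route z x tau u).
  by rewrite -opprB -scaleN1r enormZ normrN normr1 mul1r.
wlog st : s t / s <= t.
  move=> wl; have [|/ltW] := leP s t; first exact: wl.
  by rewrite sym distrC; exact: wl.
rewrite ger0_norm ?subr_ge0//; apply: enorm_le.
  by rewrite mulr_ge0 ?speed_ge0// subr_ge0.
have -> : \sum_i (route z x tau t - route z x tau s) 0 i ^+ 2 =
    \sum_i vel i ^+ 2 * (clock z x tau t i - clock z x tau s i) ^+ 2.
  by apply: eq_bigr => i _; rewrite !mxE; ring.
apply: (@le_trans _ _ ((t - s) *
   \sum_i vel i ^+ 2 * (clock z x tau t i - clock z x tau s i))).
  rewrite mulr_sumr; apply: ler_sum => i _.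
  have /andP[h1 h2] := clock_incr z x tau i st.
  rewrite [leRHS]mulrCA ler_wpM2l ?sqr_ge0// expr2 ler_wpM2r//.
under eq_bigr do rewrite mulrBr.
by rewrite sumrB !clock_energy exprMn le_eqVlt; apply/orP; left; apply/eqP; ring.
Qed.

End Schedule.
End Itineraries.

(** * Calibration: a route is a unique shortest path *)

Section Geodesics.
Variables (R : realType) (M m : nat) (X : set 'rV[R]_M).
Hypothesis hX : orthant_space m X.
Implicit Types (x y z : 'rV[R]_M) (tau kappa : 'I_M -> R) (i j : 'I_M).
Implicit Types (g h : R -> 'rV[R]_M).

Section Crossing.
Variables (z x : 'rV[R]_M) (tau : 'I_M -> R).
Hypotheses (hz : X z) (hx : X x) (htau : schedule X z x tau).
Local Notation A := (obstructed X z x).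
Local Notation B := (obstructed X x z).
Local Notation vel := (velocity X z x tau).
Local Notation D := (speed X z x tau).
Local Notation route := (route X z x tau).

(** The time of a vanishing axis is the first one at which it has its final
    value, that of an appearing axis the last one at which it has its initial
    value.  If these were in the wrong order for a clashing pair that switches
    between the end points, both axes would be positive just after the time of
    the appearing one.  Stating this for a
    path between two points of the route makes the lower bound on lengths
    available for all pairs of such points. *)
Lemma switch_times s t h : 0 <= s -> s < t -> t <= 1 ->
  is_path X (route s) (route t) h ->
  exists kappa, [/\ forall i, i \in A :|: B -> 0 <= kappa i <= 1,
    order_respecting X z x kappa,
    forall i, i \in A -> h (kappa i) 0 i = route t 0 i &
    forall i, i \in B -> h (kappa i) 0 i = route s 0 i].
Proof.
move=> s0 st t1 [ch hin h0 h1].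
have zero01 : 0 <= (0 : R) <= 1 by rewrite lexx ler01.
have one01 : 0 <= (1 : R) <= 1 by rewrite lexx ler01.
have /choice[kA hA] : forall i, exists k, i \in A ->
    [/\ 0 <= k <= 1, h k 0 i = route t 0 i &
      forall u, 0 <= u <= 1 -> h u 0 i = route t 0 i -> k <= u].
  move=> i; have [|k hk] := @first_hit R (fun u => h u 0 i) (route t 0 i) (within_coord ch) 1 one01.
  - by rewrite h1.
  - by exists k.
have /choice[kB hB] : forall i, exists k, i \in B ->
    [/\ 0 <= k <= 1, h k 0 i = route s 0 i &
      forall u, 0 <= u <= 1 -> h u 0 i = route s 0 i -> u <= k].
  move=> i; have [|k hk] := @last_hit R (fun u => h u 0 i) (route s 0 i) (within_coord ch) 0 zero01.
  - by rewrite h0.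
  - by exists k.
exists (fun i => if i \in A then kA i else kB i); split.
- move=> i; rewrite finset.in_setU; case: ifP => [iA _|_ /= iB].
    by have [] := hA i iA.
  by have [] := hB i iB.
- move=> i j iA jB cij; rewrite iA (negbTE (obstructed_disj hX hz jB)).
  have [/andP[ki0 ki1] hki ki_min] := hA i iA.
  have [/andP[kj0 kj1] hkj kj_max] := hB j jB.
  have tij := schedule_order htau iA jB cij.
  have [ttj|tjt] := leP t (tau j).
    apply: (le_trans ki1); apply: kj_max => //.
    by rewrite h1 !(routeB_eq0 hX hz)// (le_trans (ltW st)).
  have [tis|sti] := leP (tau i) s.
    apply: (le_trans _ kj0); apply: ki_min => //.
    by rewrite h0 !(routeA_eq0 htau)// (le_trans tis)// ltW.
  have hkj0 : route s 0 j = 0.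
    by apply: (routeB_eq0 hX hz) => //; rewrite ltW// (lt_le_trans sti).
  have hki0 : route t 0 i = 0.
    by apply: (routeA_eq0 htau) => //; rewrite ltW// (le_lt_trans tij).
  rewrite hki0 in hki ki_min *; rewrite hkj0 in hkj kj_max *.
  have kj_lt1 : kB j < 1.
    rewrite lt_neqAle kj1 andbT; apply/eqP => kj1'; move: hkj.
    by rewrite kj1' h1; apply/eqP; rewrite gt_eqF// (routeB_gt0 hX hz htau).
  apply: ki_min; first by rewrite kj0.
  apply/eqP/negPn/negP => hi0.
  have [|e e0 he] := @neq_near R (fun u => h u 0 i) 0 (within_coord ch) (kB j) _ hi0.
    by rewrite kj0.
  have [u [u01 ku uk]] : exists u, [/\ 0 <= u <= 1, kB j < u & `|u - kB j| < e].
    exists (Num.min (kB j + e / 2) 1); rewrite ge_min lexx orbT andbT.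
    rewrite le_min ler01 andbT lt_min kj_lt1 andbT addr_ge0//; last by rewrite ltW// divr_gt0.
    rewrite ltrDl divr_gt0//; split=> //.
    rewrite ger0_norm ?subr_ge0 ?le_min ?lerDl ?kj1 ?andbT; last by rewrite ltW// divr_gt0.
    rewrite ltrBlDl gt_min; apply/orP; left; lra.
  have hui : h u 0 i != 0 by exact: he.
  have huj : h u 0 j != 0.
    by apply/negP => /eqP /(kj_max _ u01); rewrite leNgt ku.
  have Xhu := hin u u01; have := @coord_noclash _ _ _ _ hX (h u) i j Xhu.
  by rewrite cij !lt_def hui huj !(coord_ge0 hX _ Xhu) => /(_ isT isT).
- by move=> i iA; rewrite iA; have [] := hA i iA.
- by move=> i iB; rewrite (negbTE (obstructed_disj hX hz iB)); have [] := hB i iB.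
Qed.

Section FirstVariation.
Variables (s t : R) (h : R -> 'rV[R]_M) (kappa : 'I_M -> R) (sub : seq R).
Hypotheses (h0 : h 0 = route s) (h1 : h 1 = route t).
Hypothesis kappa01 : forall i, i \in A :|: B -> 0 <= kappa i <= 1.
Hypothesis hA : forall i, i \in A -> h (kappa i) 0 i = route t 0 i.
Hypothesis hB : forall i, i \in B -> h (kappa i) 0 i = route s 0 i.
Hypothesis psub : itv_partition (0 : R) 1 sub.
Hypothesis ksub : forall i, i \in A :|: B -> kappa i \in 0 :: sub.
Local Notation T := (nth 1 (0 :: sub)).

(** Freezing the path at the switching time of the axis i turns the sum over the
    active steps into a telescoping one. *)
Lemma telescope_active i :
  \sum_(0 <= n < size sub)
    (h (T n.+1) - h (T n)) 0 i * (active X z x kappa (T n) i)%:R =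
  route t 0 i - route s 0 i.
Proof.
have T0 : T 0 = 0 by [].
have T1 : T (size sub) = 1 by exact: subdivision_last.
pose C n := Num.min (T n) (kappa i).
have step n : (n < size sub)%N -> i \in A :|: B ->
    (T n < kappa i) /\ C n.+1 = T n.+1 /\ C n = T n \/
    (kappa i <= T n) /\ C n.+1 = kappa i /\ C n = kappa i.
  move=> ns iAB; have /orP[kT|Tk] := subdivision_through_step psub (ksub iAB) ns.
    right; rewrite /C !min_r// (le_trans kT)// ltW//.
    exact: (subdivision_lt psub ns).
  left; have Tlt := lt_le_trans (subdivision_lt psub ns) Tk.
  by rewrite /C !min_l// ltW.
have [iA|iA] := boolP (i \in A).
  have iAB : i \in A :|: B by rewrite finset.in_setU iA.
  have /andP[k0 k1] := kappa01 iAB.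
  transitivity (\sum_(0 <= n < size sub) (h (C n.+1) 0 i - h (C n) 0 i)).
    apply: eq_big_nat => n /andP[_ ns]; rewrite /active iA.
    have [[lt1 [-> ->]]|[le1 [-> ->]]] := step n ns iAB.
      by rewrite lt1 mulr1 !mxE.
    by rewrite ltNge le1 mulr0 subrr.
  rewrite telescope_sumr// /C T0 T1 min_r// min_l// hA// h0//.
have [iB|iB] := boolP (i \in B).
  have iAB : i \in A :|: B by rewrite finset.in_setU iB orbT.
  have /andP[k0 k1] := kappa01 iAB.
  transitivity (\sum_(0 <= n < size sub)
      ((h (T n.+1) 0 i - h (C n.+1) 0 i) - (h (T n) 0 i - h (C n) 0 i))).
    apply: eq_big_nat => n /andP[_ ns]; rewrite /active (negbTE iA) iB.
    have [[lt1 [-> ->]]|[le1 [-> ->]]] := step n ns iAB.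
      by rewrite leNgt lt1 mulr0 !subrr.
    by rewrite le1 mulr1 !mxE; ring.
  rewrite telescope_sumr// /C T0 T1 min_r// min_l// hB// h1// subrr subr0//.
transitivity (\sum_(0 <= n < size sub) (h (T n.+1) 0 i - h (T n) 0 i)).
  apply: eq_bigr => n _.
  by rewrite /active (negbTE iA) (negbTE iB) mulr1 !mxE.
by rewrite telescope_sumr// T0 T1 h0 h1.
Qed.

(** The integral along the path h of the velocity field of the route, switched at
    the times of h, depends on the end points only. *)
Lemma first_variation :
  \sum_(0 <= n < size sub) \sum_i (h (T n.+1) - h (T n)) 0 i *
     (vel i * (active X z x kappa (T n) i)%:R) = (t - s) * D ^+ 2.
Proof.
rewrite exchange_big/= mulrBl -!(clock_energy hX hz htau) -sumrB.
apply: eq_bigr => i _.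
transitivity (vel i * (route t 0 i - route s 0 i)); last by rewrite !mxE; ring.
by rewrite -telescope_active mulr_sumr; apply: eq_bigr => n _; rewrite mulrCA.
Qed.

End FirstVariation.

Lemma mem_map01 (kappa : 'I_M -> R) (C : {set 'I_M}) :
  (forall i, i \in C -> 0 <= kappa i <= 1) ->
  forall r, r \in [seq kappa i | i <- enum C] -> 0 <= r <= 1.
Proof.
by move=> h r /mapP[i]; rewrite mem_enum => iC ->; exact: h.
Qed.

(** The field of [first_variation] has norm at most D by [active_energy], hence
    its integral (t - s) D^2 is at most D times the length. *)
Lemma length_route_ge s t h : 0 <= s -> s < t -> t <= 1 ->
  is_path X (route s) (route t) h -> (((t - s) * D)%:E <= path_length h)%E.
Proof.
move=> s0 st t1 hp; have [kappa [k01 kord hA hB]] := switch_times s0 st t1 hp.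
have [ch hin h0 h1] := hp.
have [sub psub ksub] := subdivision_through (mem_map01 k01).
have {}ksub i : i \in A :|: B -> kappa i \in 0 :: sub.
  by move=> iAB; apply: ksub; apply/mapP; exists i => //; rewrite mem_enum.
apply: (@le_trans _ _ (polygon_length h sub)%:E); last first.
  by apply: ereal_sup_ubound; exists sub.
rewrite lee_fin.
have PL0 : 0 <= polygon_length h sub.
  by rewrite /polygon_length sumr_ge0// => n _; exact: enorm_ge0.
have D0 : 0 <= D by exact: speed_ge0.
have [D00|Dn0] := eqVneq D 0; first by rewrite D00 mulr0.
have Dgt0 : 0 < D by rewrite lt_def Dn0.
rewrite -(ler_pM2l Dgt0) mulrCA -expr2.
rewrite -(first_variation h0 h1 k01 hA hB psub ksub) /polygon_length mulr_sumr.
apply: ler_sum => n _; apply: dot_le => //.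
exact: (active_energy hX hz htau).
Qed.

(** Equality case of the calibration.  With d the duration of a step, u the step
    of g and v the switched field, |u|^2 <= d^2 D^2 and |v|^2 <= D^2 give
    |u - d v|^2 <= 2 d (d D^2 - <u, v>); the brackets are nonnegative and sum up
    to 0, so that u = d v.  Thus g is the path with the same velocities but its
    own switching times, which are those of the route since g ends at x. *)
Lemma speed_lipschitz_route g : g 0 = z -> g 1 = x ->
  (forall t, 0 <= t <= 1 -> X (g t)) ->
  (forall s t, 0 <= s <= 1 -> 0 <= t <= 1 -> enorm (g t - g s) <= D * `|t - s|) ->
  forall t, 0 <= t <= 1 -> g t = route t.
Proof.
move=> g0 g1 gX gD.
have gp : is_path X (route 0) (route 1) g.
  by rewrite (route0 hX hz htau) (route1 hX hz hx htau); split=> //;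
    exact: lipschitz_continuous gD.
have [kappa [k01 kord hA hB]] := switch_times (lexx 0) ltr01 (lexx 1) gp.
have {gp}[_ _ gt0 gt1] := gp.
have lin t : 0 <= t <= 1 -> forall i, g t 0 i = z 0 i + vel i * clock X z x kappa t i.
  move=> t01.
  have l01 r : r \in t :: [seq kappa i | i <- enum (A :|: B)] -> 0 <= r <= 1.
    by rewrite inE => /orP[/eqP->//|]; exact: mem_map01.
  have [sub psub ksub] := subdivision_through l01.
  have tsub : t \in 0 :: sub by apply: ksub; rewrite inE eqxx.
  have {}ksub i : i \in A :|: B -> kappa i \in 0 :: sub.
    move=> iAB; apply: ksub; rewrite inE; apply/orP; right.
    by apply/mapP; exists i => //; rewrite mem_enum.
  pose T := nth 1 (0 :: sub).
  pose V n i : R := vel i * (active X z x kappa (T n) i)%:R.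
  pose Dl n i : R := (g (T n.+1) - g (T n)) 0 i.
  have T01 n : (n <= size sub)%N -> 0 <= T n <= 1 by exact: subdivision01.
  have Tlt n : (n < size sub)%N -> T n < T n.+1 by exact: subdivision_lt.
  have V2 n : \sum_i V n i ^+ 2 <= D ^+ 2.
    exact: (active_energy hX hz htau).
  have D2 n : (n < size sub)%N ->
      \sum_i Dl n i ^+ 2 <= ((T n.+1 - T n) * D) ^+ 2.
    move=> ns; have c0 : 0 <= (T n.+1 - T n) * D.
      by rewrite mulr_ge0 ?speed_ge0// subr_ge0 ltW// Tlt.
    rewrite -enorm_sqr ler_pXn2r// ?nnegrE ?enorm_ge0//.
    have d0 : 0 <= T n.+1 - T n by rewrite subr_ge0 ltW// Tlt.
    rewrite mulrC -[X in D * X](ger0_norm d0).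
    by apply: gD; apply: T01 => //; exact: ltnW.
  have fv := first_variation gt0 gt1 k01 hA hB psub ksub.
  rewrite subr0 mul1r in fv.
  pose gap n := (T n.+1 - T n) * D ^+ 2 - \sum_i Dl n i * V n i.
  have sq n : (n < size sub)%N ->
      \sum_i (Dl n i - (T n.+1 - T n) * V n i) ^+ 2 <= 2 * (T n.+1 - T n) * gap n.
    move=> ns; have -> : \sum_i (Dl n i - (T n.+1 - T n) * V n i) ^+ 2 =
        \sum_i Dl n i ^+ 2 - 2 * (T n.+1 - T n) * \sum_i Dl n i * V n i +
        (T n.+1 - T n) ^+ 2 * \sum_i V n i ^+ 2.
      rewrite !mulr_sumr -sumrB -big_split/=; apply: eq_bigr => i _; ring.
    have h1 := Tlt n ns; have h3 := D2 n ns; rewrite /gap exprMn in h3 *.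
    have : (T n.+1 - T n) ^+ 2 * \sum_i V n i ^+ 2 <= (T n.+1 - T n) ^+ 2 * D ^+ 2.
      by rewrite ler_wpM2l// sqr_ge0.
    lra.
  (* The gaps are nonnegative with sum 0, hence the steps of g are those of V. *)
  have gap_ge0 n : (n < size sub)%N -> 0 <= gap n.
    move=> ns; have := sq n ns; have := Tlt n ns => h1 h2.
    have : 0 <= 2 * (T n.+1 - T n) * gap n.
      by apply: le_trans h2; apply: sumr_ge0 => i _; exact: sqr_ge0.
    by rewrite pmulr_rge0// mulr_gt0// subr_gt0.
  have gap0 n : (n < size sub)%N -> gap n = 0.
    have : \sum_(0 <= k < size sub) gap k = 0.
      rewrite sumrB -mulr_suml telescope_sumr// -/T.
      rewrite {1}/T subdivision_last// [T 0]/= subr0 mul1r.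
      by rewrite [X in _ - X]fv subrr.
    rewrite big_mkord => /eqP; rewrite psumr_eq0 => [|k _]; last exact: gap_ge0.
    move=> /allP h ns; apply/eqP; apply: (h (Ordinal ns)).
    by rewrite mem_index_enum.
  have Dl_eq n i : (n < size sub)%N -> Dl n i = (T n.+1 - T n) * V n i.
    move=> ns; have := sq n ns; rewrite gap0// mulr0 => s0.
    have /eqP : \sum_i (Dl n i - (T n.+1 - T n) * V n i) ^+ 2 == 0.
      by rewrite eq_le s0 sumr_ge0// => k _; exact: sqr_ge0.
    move=> /eqP; rewrite psumr_eq0 => [|k _]; last exact: sqr_ge0.
    move=> /allP /(_ i); rewrite mem_index_enum => /(_ isT).
    by rewrite /= sqrf_eq0 subr_eq0 => /eqP.
  have nodes n i : (n <= size sub)%N ->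
      g (T n) 0 i = z 0 i + vel i * clock X z x kappa (T n) i.
    elim: n => [_|n IHn ns].
      rewrite [T 0]/= g0 /clock.
      have [iA|iA] := boolP (i \in A).
        have /andP[k0 _] : 0 <= kappa i <= 1 by apply: k01; rewrite finset.in_setU iA.
        by rewrite min_l// mulr0 addr0.
      have [iB|iB] := boolP (i \in B).
        have /andP[k0 _] : 0 <= kappa i <= 1 by apply: k01; rewrite finset.in_setU iB orbT.
        by rewrite min_l// subrr mulr0 addr0.
      by rewrite mulr0 addr0.
    have := Dl_eq n i ns; rewrite /Dl /V !mxE => h.
    have := IHn (ltnW ns) => IH.
    have cs : clock X z x kappa (T n.+1) i - clock X z x kappa (T n) i =
              (T n.+1 - T n) * (active X z x kappa (T n) i)%:R.
      apply: clock_step => [|iAB]; first exact: Tlt.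
      exact: (subdivision_through_step psub (ksub i iAB) ns).
    have -> : clock X z x kappa (T n.+1) i = clock X z x kappa (T n) i +
              (T n.+1 - T n) * (active X z x kappa (T n) i)%:R by rewrite -cs; ring.
    move: h IH; move=> /eqP; rewrite subr_eq => /eqP -> ->; ring.
  have /(nthP 1)[n ns <-] := tsub => i.
  exact: nodes.
have kE i : i \in A :|: B -> kappa i = tau i.
  move=> iAB; have /andP[k0 k1] := k01 i iAB.
  have := lin 1 _ i; rewrite lexx ler01 => /(_ isT); rewrite g1.
  move: iAB; rewrite finset.in_setU => /orP[iA|iB].
    have zi := obstructed_gt0 iA; have /andP[t0 _] := schedule01A htau iA.
    rewrite (obstructed0 hX hx iA) /clock iA min_r// => kE.
    have {kE} : z 0 i * kappa i = z 0 i * tau i.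
      move/eqP: kE; rewrite eq_sym addr_eq0 (velocityA tau iA) mulNr opprK => /eqP zE.
      by rewrite [in RHS]zE; field; exact: lt0r_neq0.
    by apply/mulfI; exact: lt0r_neq0.
  have xi := obstructed_gt0 iB; have /andP[_ t1] := schedule01B htau iB.
  have t1' : 1 - tau i != 0 by rewrite gt_eqF// subr_gt0.
  rewrite (obstructed0 hX hz iB) (velocityB hX tau hz iB) (clockB hX hz)// min_r// add0r => kE.
  have : x 0 i * (1 - kappa i) = x 0 i * (1 - tau i).
    by rewrite [in RHS]kE; field.
  move/(mulfI (lt0r_neq0 xi)); lra.
move=> t t01; apply/rowP => i; rewrite lin// mxE; congr (_ + _ * _).
rewrite /clock; case: ifPn => [iA|iA].
  by rewrite kE// finset.in_setU iA.
case: ifPn => [iB|//]; by rewrite kE// finset.in_setU iB orbT.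
Qed.

End Crossing.

End Geodesics.

(** * Every pair of points has a schedule *)

Section Blocks.
Variables (R : realType) (M m : nat) (X : set 'rV[R]_M).
Hypothesis hX : orthant_space m X.
Implicit Types (x y z : 'rV[R]_M) (i j : 'I_M) (L : 'I_M -> {set 'I_M}).

Definition weight z x i : R := if i \in obstructed X z x then z 0 i ^+ 2 else 0.

Definition precedes z x i j : bool :=
  [&& i \in obstructed X z x, j \in obstructed X x z & clash X i j].

(** The conditions on the blocks L i of isotonic regression, written without
    division or square root: in this form they are polynomial in z, and being
    nonstrict they survive a passage to the limit, when distinct blocks may
    acquire the same time. *)
Record block_system z x L : Prop := BlockSystem {
  block_refl : forall i, i \in obstructed X z x :|: obstructed X x z -> i \in L i;
  block_sub : forall i, L i \subset obstructed X z x :|: obstructed X x z;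
  block_eq : forall i j, j \in L i -> L j = L i;
  block_gt0 : forall i, i \in obstructed X z x :|: obstructed X x z ->
    0 < mass (weight z x) (L i) /\ 0 < mass (weight x z) (L i);
  block_order : forall i j, precedes z x i j ->
    mass (weight z x) (L i) * mass (weight x z) (L j) <=
    mass (weight z x) (L j) * mass (weight x z) (L i);
  block_upper : forall U i,
    closed_in (precedes z x) (obstructed X z x :|: obstructed X x z) U ->
    i \in obstructed X z x :|: obstructed X x z ->
    mass (weight z x) (U :&: L i) * mass (weight x z) (L i) <=
    mass (weight z x) (L i) * mass (weight x z) (U :&: L i) }.

(** The minimizer of P / t + Q / (1 - t). *)
Definition block_time z x L i : R :=
  let a := Num.sqrt (mass (weight z x) (L i)) in
  let b := Num.sqrt (mass (weight x z) (L i)) in a / (a + b).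

Lemma weight_ge0 z x i : 0 <= weight z x i.
Proof. by rewrite /weight; case: ifP => // _; exact: sqr_ge0. Qed.

Lemma weight_gt0 z x i : i \in obstructed X z x -> 0 < weight z x i.
Proof. by move=> iA; rewrite /weight iA exprn_gt0// (obstructed_gt0 iA). Qed.

Lemma mass_weight_gt0 z x i (S : {set 'I_M}) :
  i \in obstructed X z x -> i \in S -> 0 < mass (weight z x) S.
Proof.
move=> iA iS; rewrite /mass (bigD1 i)//= ltr_pwDl ?weight_gt0// sumr_ge0// => j _.
exact: weight_ge0.
Qed.

Section OneSystem.
Variables (z x : 'rV[R]_M) (L : 'I_M -> {set 'I_M}).
Hypotheses (hz : X z) (hx : X x) (hL : block_system z x L).
Local Notation A := (obstructed X z x).
Local Notation B := (obstructed X x z).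
Local Notation p := (weight z x).
Local Notation q := (weight x z).
Local Notation tau := (block_time z x L).

Lemma block_sum_le (F G : 'I_M -> R) :
  (forall i, i \in A :|: B -> \sum_(j in L i) F j <= \sum_(j in L i) G j) ->
  \sum_(i in A :|: B) F i <= \sum_(i in A :|: B) G i.
Proof.
move=> FG; rewrite !(partition_big_imset L)/=; apply: ler_sum => S /imsetP[k kI ->].
have E (H : 'I_M -> R) : \sum_(i in A :|: B | L i == L k) H i = \sum_(i in L k) H i.
  apply: eq_bigl => i; apply/andP/idP => [[iI /eqP <-]|iL].
    exact: (block_refl hL).
  by rewrite (fintype.subsetP (block_sub hL k))// (block_eq hL iL).
by rewrite !E FG.
Qed.

Lemma block_time_const i j : j \in L i -> tau j = tau i.
Proof. by move=> jL; rewrite /block_time (block_eq hL jL). Qed.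

Lemma sqrt_mass_gt0 i : i \in A :|: B ->
  0 < Num.sqrt (mass p (L i)) /\ 0 < Num.sqrt (mass q (L i)).
Proof. by move=> /(block_gt0 hL)[? ?]; rewrite !sqrtr_gt0. Qed.

Lemma block_time01 i : i \in A :|: B -> 0 < tau i < 1.
Proof.
move=> /sqrt_mass_gt0[a0 b0]; rewrite /block_time divr_gt0 ?addr_gt0//=.
by rewrite ltr_pdivrMr ?addr_gt0// mul1r ltrDl.
Qed.

Lemma velocity_sqrA i : i \in A ->
  velocity X z x tau i ^+ 2 = p i / tau i ^+ 2.
Proof. by move=> iA; rewrite (velocityA _ iA) sqrrN expr_div_n /weight iA. Qed.

Lemma velocity_sqrB i : i \in B ->
  velocity X z x tau i ^+ 2 = q i / (1 - tau i) ^+ 2.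
Proof. by move=> iB; rewrite (velocityB hX _ hz iB) expr_div_n /weight iB. Qed.

Lemma sumA_weight (f : 'I_M -> R) :
  \sum_(i in A) p i * f i = \sum_(i in A :|: B) p i * f i.
Proof.
rewrite [RHS](bigID (mem A))/= [X in _ = _ + X]big1 ?addr0 => [|i /andP[_ iA]].
  by apply: eq_bigl => i; rewrite finset.in_setU; case: (i \in A); rewrite ?andbF.
by rewrite /weight (negbTE iA) mul0r.
Qed.

Lemma sumB_weight (f : 'I_M -> R) :
  \sum_(i in B) q i * f i = \sum_(i in A :|: B) q i * f i.
Proof.
rewrite [RHS](bigID (mem B))/= [X in _ = _ + X]big1 ?addr0 => [|i /andP[_ iB]].
  by apply: eq_bigl => i; rewrite finset.in_setU; case: (i \in B); rewrite ?andbF ?orbT.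
by rewrite /weight (negbTE iB) mul0r.
Qed.

(** With c = (sqrt P + sqrt Q)^2, the block contributes the amount c to the
    squared velocities of its vanishing axes and to those of its appearing axes. *)
Lemma block_time_inv i : i \in A :|: B -> exists2 c, 0 <= c &
  (tau i ^+ 2)^-1 = c / mass p (L i) /\ ((1 - tau i) ^+ 2)^-1 = c / mass q (L i).
Proof.
move=> iI; have [a0 b0] := sqrt_mass_gt0 iI; have [p0 q0] := block_gt0 hL iI.
rewrite /block_time; move: a0 b0 (sqr_sqrtr (ltW p0)) (sqr_sqrtr (ltW q0)).
set a := Num.sqrt _; set b := Num.sqrt _ => a0 b0 <- <-.
have ab0 : a + b != 0 by rewrite gt_eqF// addr_gt0.
exists ((a + b) ^+ 2); first exact: sqr_ge0.
split; first by field; rewrite ab0 gt_eqF.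
have -> : 1 - a / (a + b) = b / (a + b) by field.
by field; rewrite ab0 gt_eqF.
Qed.

Lemma schedule_blocks : schedule X z x tau.
Proof.
have sumA f : \sum_(i in A) velocity X z x tau i ^+ 2 * f i =
    \sum_(i in A :|: B) p i * ((tau i ^+ 2)^-1 * f i).
  rewrite -sumA_weight; apply: eq_bigr => i iA.
  by rewrite velocity_sqrA// mulrA.
have sumB f : \sum_(i in B) velocity X z x tau i ^+ 2 * f i =
    \sum_(i in A :|: B) q i * (((1 - tau i) ^+ 2)^-1 * f i).
  rewrite -sumB_weight; apply: eq_bigr => i iB.
  by rewrite velocity_sqrB// mulrA.
have lev (f : 'I_M -> R) (g : R -> R) k :
    \sum_(j in L k) f j * g (tau j) = mass f (L k) * g (tau k).
  by rewrite /mass mulr_suml; apply: eq_bigr => j jL; rewrite (block_time_const jL).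
split.
- exact: block_time01.
- move=> i j iA jB cij.
  have iI : i \in A :|: B by rewrite finset.in_setU iA.
  have jI : j \in A :|: B by rewrite finset.in_setU jB orbT.
  have [ai bi] := sqrt_mass_gt0 iI; have [aj bj] := sqrt_mass_gt0 jI.
  have pq : precedes z x i j by rewrite /precedes iA jB cij.
  have := ler_wsqrtr (block_order hL pq).
  have [pi0 _] := block_gt0 hL iI; have [pj0 _] := block_gt0 hL jI.
  rewrite (sqrtrM _ (ltW pi0)) (sqrtrM _ (ltW pj0)).
  rewrite /block_time ler_pdivrMr ?addr_gt0// mulrAC ler_pdivlMr ?addr_gt0//; lra.
- move=> h; rewrite sumA sumB; apply/le_anti/andP; split;
    apply: block_sum_le => k kI; have [p0 q0] := block_gt0 hL kI;
    have [c _ [c1 c2]] := block_time_inv kI.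
    rewrite (lev p (fun t => (t ^+ 2)^-1 * h t)).
    rewrite (lev q (fun t => ((1 - t) ^+ 2)^-1 * h t)) c1 c2.
    by rewrite le_eqVlt; apply/orP; left; apply/eqP; field; rewrite !gt_eqF.
  rewrite (lev p (fun t => (t ^+ 2)^-1 * h t)).
  rewrite (lev q (fun t => ((1 - t) ^+ 2)^-1 * h t)) c1 c2.
  by rewrite le_eqVlt; apply/orP; left; apply/eqP; field; rewrite !gt_eqF.
- move=> U clU; pose U' := U :&: (A :|: B).
  have clU' : closed_in (precedes z x) (A :|: B) U'.
    apply/closed_inP; split; first exact: subsetIr.
    move=> i j; rewrite !finset.in_setI => /andP[iU _] jI /and3P[iA jB cij].
    by rewrite (clU i j)// jI.
  have E (C : {set 'I_M}) : \sum_(i in C | i \in U) velocity X z x tau i ^+ 2 =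
    \sum_(i in C) velocity X z x tau i ^+ 2 * (i \in U)%:R.
    rewrite big_mkcondr/=; apply: eq_bigr => i _.
    by case: (i \in U); rewrite ?mulr1 ?mulr0.
  rewrite !E sumA sumB; apply: block_sum_le => k kI.
  have [p0 q0] := block_gt0 hL kI; have [c c0 [c1 c2]] := block_time_inv kI.
  have lev' (f : 'I_M -> R) (g : R -> R) :
      \sum_(j in L k) f j * (g (tau j) * (j \in U)%:R) = mass f (U' :&: L k) * g (tau k).
    rewrite /mass big_distrl/= [RHS]big_mkcond [LHS]big_mkcond; apply: eq_bigr => j _.
    rewrite !finset.in_setI; case: ifP => jL; last by rewrite andbF.
    rewrite (fintype.subsetP (block_sub hL k) j jL) (block_time_const jL) !andbT.
    by case: (j \in U); rewrite ?mulr1 ?mulr0.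
  rewrite (lev' p (fun t => (t ^+ 2)^-1)) (lev' q (fun t => ((1 - t) ^+ 2)^-1)) c1 c2.
  have := block_upper hL clU' kI.
  move=> ab; rewrite mulrCA [leRHS]mulrCA ler_wpM2l//.
  by rewrite ler_pdivrMr// mulrAC ler_pdivlMr// [leRHS]mulrC.
Qed.

End OneSystem.

(** The last clause says that the ratios of two different blocks differ; it makes
    the blocks recoverable from the signs of finitely many polynomials. *)
Lemma block_system_exists z x : exists L, block_system z x L /\
  forall i j, i \in obstructed X z x :|: obstructed X x z ->
     j \in obstructed X z x :|: obstructed X x z ->
     mass (weight z x) (L i) * mass (weight x z) (L j) =
     mass (weight z x) (L j) * mass (weight x z) (L i) -> L i = L j.
Proof.
set A := obstructed X z x; set B := obstructed X x z.
have [||rho [rho0 rho_mono rho_lev]] := @isotonic_blocks R _ (weight z x) (weight x z)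
    (precedes z x) (A :|: B) 0 (weight_ge0 x z).
- move=> D /closed_inP[sD clD] /finset.set0Pn[i iD]; rewrite mul0r.
  have := fintype.subsetP sD i iD; rewrite finset.in_setU => /orP[iA|iB].
    exact: mass_weight_gt0 iA iD.
  have [j jA cij] := obstructedP iB.
  apply: (mass_weight_gt0 jA); apply: (clD i) => //.
    by rewrite finset.in_setU jA.
  by rewrite /precedes jA iB clashC.
- move=> D /closed_inP[sD clD] /finset.set0Pn[i iD].
  have := fintype.subsetP sD i iD; rewrite finset.in_setU => /orP[iA|iB]; last first.
    exact: mass_weight_gt0 iB iD.
  have [j jB cij] := obstructedP iA.
  apply: (mass_weight_gt0 jB); apply: (clD i) => //.
    by rewrite finset.in_setU jB orbT.
  by rewrite /precedes jB iA.
pose L i := [set j in A :|: B | rho j == rho i]%SET.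
have pos i : i \in A :|: B ->
    0 < mass (weight z x) (L i) /\ 0 < mass (weight x z) (L i).
  move=> iI; have r0 := rho0 i iI; have [pL _] := rho_lev i iI.
  have iL : i \in L i by rewrite inE iI eqxx.
  rewrite -/(L i) in pL.
  move: (iI); rewrite finset.in_setU => /orP[iA|iB].
    have p0 := mass_weight_gt0 iA iL; split=> //.
    by move: p0; rewrite pL pmulr_rgt0.
  have q0 := mass_weight_gt0 iB iL; split=> //.
  by rewrite pL pmulr_rgt0.
exists L; split; last first.
  move=> i j iI jI; have [pi _] := rho_lev i iI; have [pj _] := rho_lev j jI.
  rewrite -/(L i) in pi; rewrite -/(L j) in pj; rewrite pi pj.
  have [_ qi] := pos i iI; have [_ qj] := pos j jI.
  rewrite -!mulrA [X in _ = _ * X]mulrC => /mulIf; rewrite mulf_neq0 ?gt_eqF// => /(_ isT) ij.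
  by apply/finset.setP => k; rewrite !inE ij.
split.
- by move=> i iI; rewrite inE iI eqxx.
- by move=> i; apply/fintype.subsetP => j; rewrite inE => /andP[].
- move=> i j; rewrite inE => /andP[_ /eqP ij].
  by apply/finset.setP => k; rewrite !inE ij.
- exact: pos.
- move=> i j eij; have /and3P[iA jB _] := eij.
  have iI : i \in A :|: B by rewrite finset.in_setU iA.
  have jI : j \in A :|: B by rewrite finset.in_setU jB orbT.
  have [pi _] := rho_lev i iI; have [pj _] := rho_lev j jI.
  rewrite -/(L i) in pi; rewrite -/(L j) in pj; rewrite pi pj.
  have [_ qi] := pos i iI; have [_ qj] := pos j jI.
  rewrite -!mulrA [X in _ <= _ * X]mulrC ler_wpM2r//; last exact: rho_mono.
  by rewrite ltW// mulr_gt0.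
- move=> U i clU iI; have [pi upi] := rho_lev i iI.
  rewrite -/(L i) in pi upi; have [_ qi] := pos i iI.
  by rewrite pi [leRHS]mulrAC ler_wpM2r//; [exact: ltW|exact: upi].
Qed.

Lemma schedule_exists z x : X z -> X x -> exists tau, schedule X z x tau.
Proof.
move=> hz hx; have [L [hL _]] := block_system_exists z x.
by exists (block_time z x L); exact: schedule_blocks.
Qed.

End Blocks.

(** * The intrinsic metric, the geodesics and their initial velocity *)

Section Distance.
Variables (R : realType) (M m : nat) (X : set 'rV[R]_M).
Hypothesis hX : orthant_space m X.
Implicit Types (x y z : 'rV[R]_M) (i j : 'I_M) (tau : 'I_M -> R).

Section Reversal.
Variables (z x : 'rV[R]_M) (tau : 'I_M -> R).
Hypotheses (hz : X z) (hx : X x) (htau : schedule X z x tau).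
Local Notation A := (obstructed X z x).
Local Notation B := (obstructed X x z).
Let rtau i := 1 - tau i.

Lemma velocity_rev i : velocity X x z rtau i = - velocity X z x tau i.
Proof.
have [iA|iA] := boolP (i \in A).
  by rewrite (velocityB hX _ hx iA) (velocityA _ iA) /rtau opprK subKr.
have [iB|iB] := boolP (i \in B).
  by rewrite (velocityA _ iB) (velocityB hX _ hz iB).
by rewrite /velocity (negbTE iA) (negbTE iB) opprB.
Qed.

Lemma velocity_rev_sqr i : velocity X x z rtau i ^+ 2 = velocity X z x tau i ^+ 2.
Proof. by rewrite velocity_rev sqrrN. Qed.

Lemma velocity_balance :
  \sum_(i in A) velocity X z x tau i ^+ 2 = \sum_(i in B) velocity X z x tau i ^+ 2.
Proof.
have := schedule_balance htau (fun=> 1).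
by under eq_bigr do rewrite mulr1; under [in RHS]eq_bigr do rewrite mulr1.
Qed.

(** Reversing time exchanges the vanishing and the appearing axes, and upper sets
    and their complements. *)
Lemma schedule_rev : schedule X x z rtau.
Proof.
split.
- move=> i; rewrite finset.setUC => /(schedule01 htau); rewrite /rtau; lra.
- move=> j i jB iA; rewrite clashC => cij; have := schedule_order htau iA jB cij.
  by rewrite /rtau; lra.
- move=> h; under eq_bigr do rewrite velocity_rev_sqr.
  under [in RHS]eq_bigr do rewrite velocity_rev_sqr.
  exact/esym/(schedule_balance htau (fun t => h (1 - t))).
- move=> U clU; pose f i := velocity X z x tau i ^+ 2.
  have Ev (C : {set 'I_M}) :
      \sum_(i in C | i \in U) velocity X x z rtau i ^+ 2 = \sum_(i in C | i \in U) f i.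
    by apply: eq_bigr => i _; exact: velocity_rev_sqr.
  have Ec (C : {set 'I_M}) : \sum_(i in C | i \in (~: U)%SET) f i =
      \sum_(i in C | i \notin U) f i by apply: eq_bigl => i; rewrite inE.
  have bal : \sum_(i in A) f i = \sum_(i in B) f i by exact: velocity_balance.
  have up : \sum_(i in A | i \notin U) f i <= \sum_(i in B | i \notin U) f i.
    rewrite -!Ec; apply: (schedule_upper htau) => i j iA jB cij.
    rewrite !inE; apply: contra; apply: clU => //; by rewrite clashC.
  rewrite !Ev; move: bal; rewrite (bigID (mem U))/= [RHS](bigID (mem U))/=; lra.
Qed.

Lemma route_rev t : route X x z rtau (1 - t) = route X z x tau t.
Proof.
apply/rowP => i; have hr := schedule_rev.
have [iA|iA] := boolP (i \in A).
  rewrite (routeB hX _ hx _ iA) (routeA htau _ iA) velocity_rev; congr (_ * _).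
  by rewrite /rtau; case: leP => ?; case: leP => ?; lra.
have [iB|iB] := boolP (i \in B).
  rewrite (routeB hX _ hz _ iB) (routeA hr _ iB) velocity_rev opprK; congr (_ * _).
  by rewrite /rtau; case: leP => ?; case: leP => ?; lra.
by rewrite !route_other//; ring.
Qed.

Lemma speed_rev : speed X x z rtau = speed X z x tau.
Proof.
congr Num.sqrt.
under eq_bigr do rewrite velocity_rev_sqr.
pose f i := velocity X z x tau i ^+ 2.
have E (C : {set 'I_M}) : \sum_i f i = \sum_(i in C) f i + \sum_(i | i \notin C) f i.
  by rewrite (bigID (mem C)).
have := E A; rewrite (E B) velocity_balance; exact: addrI.
Qed.

End Reversal.

Lemma polygon_lipschitz (g : R -> 'rV[R]_M) (K : R) (s : seq R) :
  (forall u v, 0 <= u <= 1 -> 0 <= v <= 1 -> enorm (g v - g u) <= K * `|v - u|) ->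
  itv_partition (0 : R) 1 s -> polygon_length g s <= K.
Proof.
move=> gK ps; pose T := nth 1 (0 :: s).
apply: (@le_trans _ _ (\sum_(0 <= n < size s) (K * T n.+1 - K * T n))).
  rewrite /polygon_length big_seq [leRHS]big_seq; apply: ler_sum => n.
  rewrite mem_index_iota => /andP[_ ns] /=.
  have d0 : 0 <= T n.+1 - T n by rewrite subr_ge0 ltW// (subdivision_lt ps ns).
  rewrite -mulrBr -[X in K * X](ger0_norm d0); apply: gK.
    by apply: (subdivision01 ps); exact: ltnW.
  exact: (@subdivision01 _ _ ps n.+1 ns).
rewrite telescope_sumr// /T (subdivision_last ps) [nth _ _ 0]/=.
by rewrite mulr1 mulr0 subr0.
Qed.

Section Metric.
Variables (z x : 'rV[R]_M) (tau : 'I_M -> R).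
Hypotheses (hz : X z) (hx : X x) (htau : schedule X z x tau).
Local Notation D := (speed X z x tau).
Local Notation route := (route X z x tau).

(** For t < s the bound is that for the reversed route. *)
Lemma length_route_ge_abs s t h : 0 <= s <= 1 -> 0 <= t <= 1 ->
  is_path X (route s) (route t) h -> ((`|s - t| * D)%:E <= path_length h)%E.
Proof.
move=> /andP[s0 s1] /andP[t0 t1]; have [st|ts|->] := ltgtP s t.
- by rewrite distrC gtr0_norm ?subr_gt0//; exact: (length_route_ge hX hz htau).
- rewrite gtr0_norm ?subr_gt0//.
  rewrite -(route_rev hz hx htau) -[route t](route_rev hz hx htau) => hp.
  rewrite -(speed_rev hz hx htau).
  have -> : s - t = (1 - t) - (1 - s) by lra.
  apply: (length_route_ge hX hx (schedule_rev hz hx htau)); last exact: hp; lra.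
- move=> _; rewrite subrr normr0 mul0r.
  apply: (@le_trans _ _ (polygon_length h [:: 1])%:E); last first.
    by apply: ereal_sup_ubound; exists [:: 1] => //; exact: itv_partition1.
  by rewrite lee_fin sumr_ge0// => n _; exact: enorm_ge0.
Qed.

Lemma dist_route s t : 0 <= s <= 1 -> 0 <= t <= 1 ->
  dist X (route s) (route t) = `|s - t| * D.
Proof.
move=> s01 t01; rewrite /dist.
suff -> : ereal_inf [set path_length g | g in is_path X (route s) (route t)] =
          (`|s - t| * D)%:E by [].
apply/le_anti/andP; split; last first.
  by apply: le_ereal_inf_tmp => _ [h hp <-]; exact: length_route_ge_abs.
pose g u := route (s + u * (t - s)).
have gK u v : enorm (g v - g u) <= `|s - t| * D * `|v - u|.
  apply: (le_trans (route_lipschitz hX hz htau _ _)).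
  rewrite [leRHS]mulrAC [leRHS]mulrC distrC -normrM.
  have -> : s + u * (t - s) - (s + v * (t - s)) = (s - t) * (v - u) by ring.
  by [].
have gp : is_path X (route s) (route t) g.
  split.
  - by apply: (@lipschitz_continuous _ _ _ (`|s - t| * D)) => u v _ _; exact: gK.
  - move=> u u01; apply: (route_in hX hz hx htau).
    move: s01 t01 u01 => /andP[s0 s1] /andP[t0 t1] /andP[u0 u1].
    apply/andP; split; nra.
  - by rewrite /g mul0r addr0.
  - by rewrite /g mul1r addrC subrK.
apply: (@le_trans _ _ (path_length g)); first by apply: ereal_inf_lbound; exists g.
apply: ge_ereal_sup => _ [sub psub <-]; rewrite lee_fin.
by apply: polygon_lipschitz psub => u v _ _; exact: gK.
Qed.

Lemma dist_speed : dist X z x = D.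
Proof.
have := @dist_route 0 1; rewrite (route0 hX hz htau) (route1 hX hz hx htau).
by rewrite !lexx ler01 sub0r normrN normr1 mul1r; exact.
Qed.

Lemma is_geodesic_route : is_geodesic X z x route.
Proof.
split.
- exact: (route_in hX hz hx htau).
- exact: (route0 hX hz htau).
- exact: (route1 hX hz hx htau).
- by move=> s t s01 t01; rewrite dist_route// dist_speed.
Qed.

End Metric.

Lemma enorm_le_dist z x : X z -> X x -> enorm (x - z) <= dist X z x.
Proof.
move=> hz hx; have [tau htau] := schedule_exists hX hz hx.
rewrite (dist_speed hz hx htau).
have := route_lipschitz hX hz htau 0 1.
by rewrite (route0 hX hz htau) (route1 hX hz hx htau) subr0 normr1 mulr1.
Qed.

(** The intrinsic metric dominates the Euclidean one, so that a geodesic is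
    Lipschitz with constant D for the Euclidean norm. *)
Lemma geodesic_route z x tau : X z -> X x -> schedule X z x tau ->
  forall t, 0 <= t <= 1 -> geodesic X z x t = route X z x tau t.
Proof.
move=> hz hx htau.
have /(xgetI (fun=> z)) := is_geodesic_route hz hx htau.
rewrite -/(geodesic X z x) => -[gX g0 g1 gD].
apply: (speed_lipschitz_route hX hz hx htau) => // s t s01 t01.
rewrite (le_trans (enorm_le_dist _ _))//; [exact: gX|exact: gX|].
by rewrite gD// (dist_speed hz hx htau) mulrC distrC.
Qed.

(** Before the first switching time the route is a segment, along which the axes
    that appear later are still at rest. *)
Lemma log_map_velocity z x tau : X z -> X x -> schedule X z x tau ->
  log_map X z x = \row_i (if i \in obstructed X x z then 0
                          else velocity X z x tau i).
Proof.
move=> hz hx htau; apply: cvg_lim; first exact: norm_hausdorff.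
apply: cvg_near_cst.
(* No axis switches before the time d. *)
have [d d0 hd] : exists2 d : R, 0 < d & forall i,
    i \in obstructed X z x :|: obstructed X x z -> d <= tau i.
  exists (\big[Order.min/1]_(i in obstructed X z x :|: obstructed X x z) tau i).
    apply: (big_ind (fun u => 0 < u)) => // [u v u0 v0|i /(schedule01 htau)/andP[]//].
    by rewrite lt_min u0.
  by move=> i iI; rewrite (bigD1 i)//= ge_min lexx.
near=> t.
have t0 : 0 < t by near: t; exact: nbhs_right_gt.
have td : t < d by near: t; exact: nbhs_right_lt.
have t1 : t < 1 by near: t; exact: nbhs_right_lt.
rewrite (geodesic_route hz hx htau) ?ltW//.
apply/rowP => i; rewrite !mxE addrC addKr.
case: ifPn => iB.
  rewrite (clockB hX hz)// min_l ?subrr ?mulr0//.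
  by rewrite (le_trans (ltW td))// hd// finset.in_setU iB orbT.
rewrite /clock (negbTE iB); case: ifPn => iA; last by rewrite mulrC mulfK ?gt_eqF.
rewrite min_l; first by rewrite mulrC mulfK ?gt_eqF.
by rewrite (le_trans (ltW td))// hd// finset.in_setU iA.
Unshelve. all: by end_near. Qed.

End Distance.

(** * The translated logarithm and the support of a geodesic *)

Section LogarithmMap.
Variables (R : realType) (M m : nat) (X : set 'rV[R]_M).
Hypothesis hX : orthant_space m X.
Implicit Types (x y z w : 'rV[R]_M) (i j : 'I_M) (tau : 'I_M -> R).

Lemma Phi_blocks z x (L : 'I_M -> {set 'I_M}) : X z -> X x ->
  block_system X z x L ->
  Phi X x z = \row_i
    (if i \in obstructed X z x then
       - (Num.sqrt (mass (weight X x z) (L i)) /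
          Num.sqrt (mass (weight X z x) (L i))) * z 0 i
     else if i \in obstructed X x z then 0 else x 0 i).
Proof.
move=> hz hx hL; rewrite /Phi (log_map_velocity hX hz hx (schedule_blocks hX hz hL)).
apply/rowP => i; rewrite !mxE; case: ifPn => iB.
  by rewrite (negbTE (obstructed_disj hX hz iB)) add0r (obstructed0 hX hz iB).
rewrite /velocity (negbTE iB); case: ifPn => iA; last by rewrite subrK.
have [|a0 b0] := sqrt_mass_gt0 hL (i := i); first by rewrite finset.in_setU iA.
rewrite /block_time; field.
by rewrite !gt_eqF// addr_gt0.
Qed.

Lemma obstructed_sym0 z y : obstructed X z y = finset.set0 ->
  obstructed X y z = finset.set0.
Proof.
move=> A0; apply/finset.setP => i; rewrite [RHS]inE; apply/negbTE/negP.
by move=> /obstructedP[j]; rewrite A0 inE.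
Qed.

(** Without obstructed axes the two points lie in the closure of one orthant. *)
Lemma straight_log_dist z y : X z -> X y -> obstructed X z y = finset.set0 ->
  log_map X z y = y - z /\ dist X z y = enorm (y - z).
Proof.
move=> hz hy A0; have B0 := obstructed_sym0 A0.
have [tau htau] := schedule_exists hX hz hy.
rewrite (log_map_velocity hX hz hy htau) (dist_speed hX hz hy htau).
have vE i : velocity X z y tau i = (y - z) 0 i.
  by rewrite /velocity A0 B0 !inE !mxE.
split; first by apply/rowP => i; rewrite mxE B0 inE vE.
congr Num.sqrt; apply: eq_big => i; first by rewrite A0 inE.
by rewrite vE.
Qed.

(** Uniqueness: at an obstructed axis the logarithm is - z_i / tau_i < - z_i, so
    a vector lam w that keeps z + lam w positive on the axes of z is not the
    logarithm of a point with an obstructed axis. *)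
Lemma geodesic_pointE z w (lam : R) : X z -> X (z + lam *: w) -> 0 <= lam ->
  (forall i, 0 < z 0 i -> 0 < (z + lam *: w) 0 i) ->
  (forall i j, 0 < z 0 i -> 0 < (z + lam *: w) 0 j -> ~~ clash X i j) ->
  geodesic_point X z lam w = z + lam *: w.
Proof.
move=> hz hy lam0 pos noclash.
have A0 : obstructed X z (z + lam *: w) = finset.set0.
  apply/finset.setP => i; rewrite !inE; apply/negbTE/negP.
  move=> /andP[zi /existsP[j /andP[yj]]]; apply/negP; exact: noclash.
have [logE distE] := straight_log_dist hz hy A0.
have yz : z + lam *: w - z = lam *: w by rewrite addrC addKr.
apply: xget_unique.
  by split=> //; rewrite ?logE ?distE yz// enormZ ger0_norm.
move=> y' [hy' _ log'].
have [tau htau] := schedule_exists hX hz hy'.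
have A0' : obstructed X z y' = finset.set0.
  apply/finset.setP => i; rewrite [RHS]inE; apply/negbTE/negP => iA.
  have := congr1 (fun u : 'rV[R]_M => u 0 i) log'.
  rewrite (log_map_velocity hX hz hy' htau) !mxE.
  rewrite (negbTE (obstructed_disj hX hy' iA)) (velocityA _ iA) => h.
  have zi := obstructed_gt0 iA; have := pos i zi; rewrite !mxE -h subr_gt0.
  have /andP[t0 t1] := schedule01A htau iA.
  by rewrite ltr_pdivrMr// ltr_pMr// ltNge (ltW t1).
have [log'E _] := straight_log_dist hz hy' A0'.
by rewrite -log' log'E addrC subrK.
Qed.

Lemma common_axesE z x : X z -> X x -> common_axes X z x =
  (pos_axes z :|: pos_axes x) :\: (obstructed X z x :|: obstructed X x z).
Proof.
move=> hz hx; apply/finset.setP => e.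
have compatP (u v : 'rV[R]_M) : X u -> X v -> 0 < u 0 e ->
    compatible X (finset.set1 e) (pos_axes v) <-> e \notin obstructed X u v.
  move=> hu hv ue; rewrite /compatible; split.
    move=> /(stratumP hX) nc; apply/negP; rewrite inE ue/= => /existsP[j /andP[vj]].
    by apply/negP/nc; rewrite !inE ?eqxx ?vj ?orbT.
  move=> nA; apply/(stratumP hX) => i j.
  have nc k : 0 < v 0 k -> ~~ clash X e k.
    move=> vk; apply: contra nA => cek; rewrite inE ue/=.
    by apply/existsP; exists k; rewrite vk.
  rewrite !inE => /orP[/eqP->|vi] /orP[/eqP->|vj].
  - exact: (coord_noclash hX hu).
  - exact: nc.
  - by rewrite clashC; exact: nc.
  - exact: (coord_noclash hX hv).
have zA : e \in obstructed X z x -> 0 < z 0 e /\ x 0 e = 0.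
  by move=> eA; rewrite (obstructed_gt0 eA) (obstructed0 hX hx eA).
have xB : e \in obstructed X x z -> 0 < x 0 e /\ z 0 e = 0.
  by move=> eB; rewrite (obstructed_gt0 eB) (obstructed0 hX hz eB).
rewrite finset.in_setD !finset.in_setU negb_or.
move: (compatP z x hz hx) (compatP x z hx hz) zA xB.
move: (e \in obstructed X z x) (e \in obstructed X x z) => a b cA cB zA xB.
rewrite /common_axes !inE.
apply/orP/andP => [[/orP[/andP[ze xe]|/andP[ze /asboolP/(cA ze) nA]]|
                    /andP[xe /asboolP/(cB xe) nB]]|].
- rewrite ze; split=> //; apply/andP; split; apply/negP.
    by move=> /zA[_ xe0]; rewrite xe0 ltxx in xe.
  by move=> /xB[_ xe0]; rewrite xe0 ltxx in ze.
- rewrite ze nA; split=> //=; apply/negP.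
  by move=> /xB[_ xe0]; rewrite xe0 ltxx in ze.
- rewrite xe nB orbT; split=> //=; rewrite andbT; apply/negP.
  by move=> /zA[_ xe0]; rewrite xe0 ltxx in xe.
- move=> [/andP[nA nB]] /orP[ze|xe].
    by left; apply/orP; right; rewrite ze; apply/asboolP/cA.
  by right; rewrite xe; apply/asboolP/cB.
Qed.

Section Support.
Variables (z x : 'rV[R]_M) (tau : 'I_M -> R) (J : seq 'I_M).
Hypotheses (hz : X z) (hx : X x) (htau : schedule X z x tau).
Local Notation A := (obstructed X z x).
Local Notation B := (obstructed X x z).
Local Notation T := [seq tau j | j <- J].
Hypothesis pathJ : path <%R 0 T.
Hypothesis JI : forall j, j \in J -> j \in A :|: B.
Hypothesis coverJ : forall i, i \in A :|: B -> tau i \in T.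
Hypothesis levelA : forall j, j \in J -> exists2 i, i \in A & tau i = tau j.
Hypothesis levelB : forall j, j \in J -> exists2 i, i \in B & tau i = tau j.

Let sub := rcons T 1.

(** The switching times in increasing order, followed by 1, subdivide [0, 1] into
    the time intervals of the carrier. *)
Lemma partition_sub : itv_partition (0 : R) 1 sub.
Proof.
rewrite /itv_partition /sub last_rcons rcons_path pathJ eqxx; split=> //=.
case/lastP: (J) JI => [|J' j] JI'; first by rewrite ltr01.
rewrite map_rcons last_rcons.
by have /(schedule01 htau)/andP[] : j \in A :|: B by apply: JI'; rewrite mem_rcons inE eqxx.
Qed.

Let node := nth 1 (0 :: sub).

Lemma size_sub : size sub = (size J).+1.
Proof. by rewrite size_rcons size_map. Qed.

Lemma nodeE n : (n <= size J)%N -> node n = nth 0 (0 :: T) n.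
Proof.
case: n => //= n nJ; rewrite /node /sub /= nth_rcons size_map nJ.
by apply: set_nth_default; rewrite size_map.
Qed.

Lemma tau_step i n : i \in A :|: B -> (n <= size J)%N ->
  (tau i <= node n) || (node n.+1 <= tau i).
Proof.
move=> iI nJ; apply: (subdivision_through_step partition_sub).
  by rewrite inE mem_rcons inE (coverJ iI) !orbT.
by rewrite size_sub.
Qed.

(** The stratum of the route just after the time t. *)
Definition stage (t : R) : {set 'I_M} :=
  common_axes X z x :|: (A :&: [set i | (t < tau i)%R]%SET)
  :|: (B :&: [set i | (tau i <= t)%R]%SET).

Lemma mem_stageA t i : i \in A -> (i \in stage t) = (t < tau i).
Proof.
move=> iA; have iB := obstructed_disj hX hx iA.
rewrite /stage common_axesE// !(finset.in_setU, finset.in_setD, finset.in_setI).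
by rewrite iA (negbTE iB)/= orbF inE.
Qed.

Lemma mem_stageB t i : i \in B -> (i \in stage t) = (tau i <= t).
Proof.
move=> iB; have iA := obstructed_disj hX hz iB.
rewrite /stage common_axesE// !(finset.in_setU, finset.in_setD, finset.in_setI).
by rewrite iB (negbTE iA)/= inE.
Qed.

Lemma mem_stageC t i : i \notin A -> i \notin B ->
  (i \in stage t) = (0 < z 0 i) || (0 < x 0 i).
Proof.
move=> iA iB.
rewrite /stage common_axesE// !(finset.in_setU, finset.in_setD, finset.in_setI).
by rewrite (negbTE iA) (negbTE iB)/= !orbF !inE.
Qed.

Lemma pos_route t : 0 < t < 1 -> (forall i, i \in B -> tau i != t) ->
  pos_axes (route X z x tau t) = stage t.
Proof.
move=> /andP[t0 t1] tB; apply/finset.setP => i; rewrite inE.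
have [iA|iA] := boolP (i \in A); first by rewrite mem_stageA// (routeA_gt0 htau).
have [iB|iB] := boolP (i \in B).
  by rewrite mem_stageB// (routeB_gt0 hX hz htau)// lt_neqAle tB.
rewrite mem_stageC// route_other//.
have z0 := coord_ge0 hX i hz; have x0 := coord_ge0 hX i hx.
have [zi|zi] := ltP 0 (z 0 i) => /=; first nra.
have [xi|xi] := ltP 0 (x 0 i) => /=; first nra.
by apply/negbTE; rewrite -leNgt; nra.
Qed.

Lemma stage_const n t : (n <= size J)%N -> node n <= t < node n.+1 ->
  stage t = stage (node n).
Proof.
move=> nJ /andP[nt tn]; apply/finset.setP => i.
have [iA|iA] := boolP (i \in A).
  rewrite !mem_stageA//.
  have iI : i \in A :|: B by rewrite finset.in_setU iA.
  have /orP[h|h] := tau_step iI nJ.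
    by rewrite !ltNge h (le_trans h).
  by rewrite (lt_le_trans tn h) (lt_le_trans (le_lt_trans nt tn) h).
have [iB|iB] := boolP (i \in B).
  rewrite !mem_stageB//.
  have iI : i \in A :|: B by rewrite finset.in_setU iB orbT.
  have /orP[h|h] := tau_step iI nJ.
    by rewrite h (le_trans h).
  by rewrite !leNgt (lt_le_trans tn h) (lt_le_trans (le_lt_trans nt tn) h).
by rewrite !mem_stageC.
Qed.

Lemma node_lt n : (n <= size J)%N -> node n < node n.+1.
Proof. by move=> nJ; apply: (subdivision_lt partition_sub); rewrite size_sub. Qed.

Lemma node01 n : (n <= (size J).+1)%N -> 0 <= node n <= 1.
Proof. by move=> nJ; apply: (subdivision01 partition_sub); rewrite size_sub. Qed.

Lemma stage_step t : 0 <= t < 1 ->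
  exists2 n, (n <= size J)%N & node n <= t < node n.+1.
Proof.
move=> /andP[t0 t1].
have exn : exists n, (n <= size J)%N && (node n <= t) by exists 0%N; rewrite t0.
have bn n : (n <= size J)%N && (node n <= t) -> (n <= size J)%N by case/andP.
have [n /andP[nJ nt] maxn] := ex_maxnP exn bn.
exists n => //; rewrite nt/=; move: nJ; rewrite leq_eqVlt => /orP[/eqP nJ|nJ].
  have := subdivision_last partition_sub; rewrite size_sub -nJ -/node => ->.
  exact: t1.
rewrite ltNge; apply/negP => h; have := maxn n.+1; rewrite nJ h => /(_ isT).
by rewrite ltnn.
Qed.

(** Each switching time is both the death time of an axis and the birth time of
    another one ([levelA], [levelB]).  So the stratum changes at each switching
    time, and the route does not return to a stage: an axis present in the
    earlier of two stages dies, and an axis of the later one is born, at the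
    time when the later stage begins. *)
Lemma is_carrier_stages : is_carrier X z x (stage 0 :: [seq stage t | t <- T]).
Proof.
have gE := geodesic_route hX hz hx htau.
have nthE n : (n <= size J)%N ->
    nth finset.set0 (stage 0 :: [seq stage t | t <- T]) n = stage (node n).
  move=> nJ; rewrite nodeE// -[stage 0 :: _]/([seq stage t | t <- 0 :: T]).
  by rewrite (nth_map 0)//= size_map.
have memE S : S \in stage 0 :: [seq stage t | t <- T] <->
    exists2 n, (n <= size J)%N & S = stage (node n).
  split.
    move=> /(nthP finset.set0)[n]; rewrite /= !size_map ltnS => nJ <-.
    by exists n => //; exact: nthE.
  move=> [n nJ ->]; rewrite -nthE//; apply: mem_nth.
  by rewrite /= !size_map.
have orth S u : X u -> orthant S u <-> pos_axes u = S.
  move=> Xu; split; first exact: orthant_pos_axes.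
  by move=> <-; have [] := mem_stratum hX Xu.
split.
- move=> S; rewrite memE; split.
    move=> [n nJ ->]; exists (node n), (node n.+1).
    have /andP[n0 _] := node01 (leqW nJ); have /andP[_ n1] := @node01 n.+1 nJ.
    split=> //; first exact: node_lt.
    move=> t /andP[nt tn].
    have t01 : 0 < t < 1 by rewrite (le_lt_trans n0 nt) (lt_le_trans tn n1).
    have t01' : 0 <= t <= 1 by move: t01 => /andP[/ltW -> /ltW ->].
    rewrite gE//; apply/orth; first exact: (route_in hX hz hx htau).
    rewrite pos_route//; first by apply: stage_const => //; rewrite (ltW nt).
    move=> i iB; have iI : i \in A :|: B by rewrite finset.in_setU iB orbT.
    have /orP[h|h] := tau_step iI nJ.
    + by rewrite lt_eqF// (le_lt_trans h).
    + by rewrite gt_eqF// (lt_le_trans tn).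
  move=> [a [b [a0 ab b1 hS]]].
  have gS t : a < t < b -> pos_axes (route X z x tau t) = S.
    move=> tab; have t01 : 0 <= t <= 1.
      by move/andP: tab => [at_ tb]; rewrite (le_trans a0 (ltW at_)) (le_trans (ltW tb) b1).
    have := hS t tab; rewrite gE// => /orth; apply.
    exact: (route_in hX hz hx htau).
  pose t := (a + b) / 2.
  have tab : a < t < b by rewrite /t; lra.
  have t01 : 0 < t < 1.
    by move/andP: tab => [at_ tb]; rewrite (le_lt_trans a0 at_) (lt_le_trans tb b1).
  (* An axis born at the time t would be positive just after t but not at t. *)
  have tB i : i \in B -> tau i != t.
    move=> iB; apply/eqP => it.
    pose u := (t + b) / 2.
    have uab : a < u < b by move: tab; rewrite /u; lra.
    have tu : t < u by move: tab; rewrite /u; lra.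
    have : (i \in pos_axes (route X z x tau t)) = (i \in pos_axes (route X z x tau u)).
      by rewrite !gS.
    by rewrite !inE !(routeB_gt0 hX hz htau)// it ltxx tu.
  have [|n nJ ntn] := @stage_step t; first by case/andP: t01 => /ltW -> ->.
  by exists n => //; rewrite -(gS t tab) pos_route//; exact: stage_const.
- move=> i j; rewrite /= !size_map ltnS => /andP[ij jJ] t u t01 u01.
  have iJ : (i < size J)%N := leq_trans ij jJ.
  rewrite !nthE ?(ltnW iJ)// !gE// => /(orthant_pos_axes) ti /(orthant_pos_axes) uj.
  have j0 : (0 < j)%N by exact: leq_ltn_trans ij.
  have [e eJ ej] : exists2 e, e \in J & node j = tau e.
    apply/mapP; rewrite nodeE// -(prednK j0)/=; apply: mem_nth.
    by rewrite size_map prednK.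
  have Tij : node i < node j.
    apply: (lt_le_trans (node_lt (ltnW iJ))); apply: (subdivision_mono partition_sub).
    by rewrite ij size_sub ltnW.
  have [a aA ta] := levelA eJ; have [b bB tb] := levelB eJ.
  have : a \in pos_axes (route X z x tau t) by rewrite ti mem_stageA// ta -ej.
  have : b \in pos_axes (route X z x tau u) by rewrite uj mem_stageB// tb -ej.
  rewrite !inE (routeB_gt0 hX hz htau)// (routeA_gt0 htau)// ta tb.
  by move=> h1 h2; exact: lt_trans h2 h1.
Qed.

Lemma is_support_levels : is_support X z x
  (common_axes X z x :: [seq A :&: [set i | tau i == tau j]%SET | j <- J])
  (common_axes X z x :: [seq B :&: [set i | tau i == tau j]%SET | j <- J]).
Proof.
exists (stage 0), [seq stage t | t <- T]; split; first exact: is_carrier_stages.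
all: congr cons; apply: (@eq_from_nth _ finset.set0);
  rewrite ?size_pairmap !size_map// => n nJ.
all: have [j0 _] : exists j0 : 'I_M, true by case: (J) nJ => // j0 *; exists j0.
all: rewrite (nth_map j0)// (nth_pairmap finset.set0) ?size_map//.
all: rewrite -[stage 0 :: _]/([seq stage t | t <- 0 :: T]) !(nth_map 0) ?size_map//;
  try by rewrite /= size_map ltnW.
all: rewrite -(nodeE (ltnW nJ)) -[nth 0 [seq _ | _ <- _] n]/(nth 0 (0 :: T) n.+1) -nodeE//.
all: have Tj : node n.+1 = tau (nth j0 J n) by rewrite nodeE//= (nth_map j0).
all: have lt := node_lt (ltnW nJ); rewrite -Tj; apply/finset.setP => i.
all: have lvl t : (i \in [set k | tau k == t]%SET) = (tau i == t) by rewrite inE.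
all: rewrite finset.in_setD finset.in_setI lvl.
all: have [iA|iA] := boolP (i \in A); [have iI : i \in A :|: B by rewrite finset.in_setU iA|
  have [iB|iB] := boolP (i \in B); [have iI : i \in A :|: B by rewrite finset.in_setU iB orbT|]].
all: rewrite ?iA ?(negbTE iA) ?iB ?(negbTE iB)/=.
all: try by rewrite !mem_stageC// andNb.
- rewrite !mem_stageA// -leNgt eq_le/=; have /orP[h|h] := tau_step iI (ltnW nJ).
    by rewrite [node n < _]ltNge h/= andbF [node n.+1 <= _]leNgt (le_lt_trans h lt) andbF.
  by rewrite h (lt_le_trans lt h) andbT.
- rewrite !mem_stageB//; have /orP[h|h] := tau_step iI (ltnW nJ).
    by rewrite h (le_trans h (ltW lt)).
  by rewrite [tau i <= node n]leNgt (lt_le_trans lt h) andbF.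
- rewrite !mem_stageA// ?(negbTE (obstructed_disj hX hx iA))/=.
  have /orP[h|h] := tau_step iI (ltnW nJ).
    by rewrite [node n.+1 < _]ltNge (le_trans h (ltW lt)) andbF.
  by rewrite (lt_le_trans lt h).
- rewrite !mem_stageB// -ltNge eq_le/=; have /orP[h|h] := tau_step iI (ltnW nJ).
    by rewrite ltNge h/= [node n.+1 <= _]leNgt (le_lt_trans h lt) andbF.
  by rewrite h (lt_le_trans lt h) andbT.
Qed.

End Support.
End LogarithmMap.

(** * One-sided limits *)

Section RightLimits.
Variables (R : realType) (M : nat).

Lemma near_right_itv (P : R -> Prop) : (\forall t \near (0 : R)^'+, P t) ->
  exists2 e : R, 0 < e & forall t, 0 < t < e -> P t.
Proof.
move=> [e /= e0 he]; exists e => // t /andP[t0 te].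
by apply: he => //=; rewrite sub0r normrN gtr0_norm.
Qed.

(** The sign near 0 is that of the lowest nonzero coefficient. *)
Lemma poly_sign_right (p : {poly R}) :
  exists s : R, \forall t \near (0 : R)^'+, Num.sg p.[t] = s.
Proof.
elim/poly_ind: p => [|p c [s IHp]].
  by exists 0; near=> t; rewrite horner0 sgr0.
have [->|c0] := eqVneq c 0.
  exists s; near=> t.
  have t0 : 0 < t by near: t; exact: nbhs_right_gt.
  by rewrite addr0 hornerMX sgrM (gtr0_sg t0) mulr1; near: t.
exists (Num.sg c).
have cv : (p * 'X + c%:P).[t] @[t --> (0 : R)^'+] --> c.
  rewrite -[X in _ --> X](_ : (p * 'X + c%:P).[0] = c); last first.
    by rewrite !hornerE; ring.
  by apply: cvg_at_right_filter; exact: continuous_horner.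
have [cgt|clt] := ltP 0 c.
  near=> t; rewrite gtr0_sg; first by rewrite gtr0_sg.
  by near: t; exact: (cvgr_gt c cv).
have {}clt : c < 0 by rewrite lt_neqAle c0.
near=> t; rewrite ltr0_sg; first by rewrite ltr0_sg.
by near: t; exact: (cvgr_lt c cv).
Unshelve. all: by end_near. Qed.

Lemma cvg_row (f : R -> 'rV[R]_M) (l : 'rV[R]_M) (G : set_system R) :
  Filter G -> (forall i, f t 0 i @[t --> G] --> l 0 i) -> f t @[t --> G] --> l.
Proof.
move=> FG fl; rewrite (row_sum_delta l).
rewrite (_ : f = fun t => \sum_j f t 0 j *: delta_mx 0 j); last first.
  by apply/funext => t; exact: row_sum_delta.
apply: cvg_big => [|i _]; last first.
  by apply: cvgZr_tmp; exact: fl.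
by move=> x; exact: add_continuous.
Qed.

End RightLimits.

Lemma enum_levels (d : Order.disp_t) (T : orderType d) (I : finType) (f : I -> T)
    (S : {set I}) :
  exists J : seq I, [/\ sorted <%O [seq f j | j <- J],
    forall j, j \in J -> j \in S & forall i, i \in S -> f i \in [seq f j | j <- J]].
Proof.
pose s := sort <=%O (undup [seq f i | i <- enum S]).
have ssort : sorted <%O s by rewrite sort_lt_sorted undup_uniq.
have sE t : (t \in s) = (t \in [seq f i | i <- enum S]).
  by rewrite mem_sort mem_undup.
have [J JS Js] : exists2 J, forall j, j \in J -> j \in S & [seq f j | j <- J] = s.
  have : forall t, t \in s -> exists2 i, i \in S & f i = t.
    by move=> t; rewrite sE => /mapP[i]; rewrite mem_enum => iS ->; exists i.
  elim: (s) => [_|t s' IHs h]; first by exists [::].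
  have [|J JS <-] := IHs; first by move=> u us; apply: h; rewrite inE us orbT.
  have [i iS <-] := h t (mem_head _ _).
  by exists (i :: J) => // j; rewrite inE => /orP[/eqP->//|/JS].
exists J; rewrite Js; split=> // i iS.
by rewrite sE; apply: map_f; rewrite mem_enum.
Qed.

(** * Schedules along a short segment *)

Section Perturbation.
Variables (R : realType) (M : nat) (X : set 'rV[R]_M).
Implicit Types (u v y : 'rV[R]_M) (i j : 'I_M).

Lemma obstructed_pos_axes u v y : pos_axes u = pos_axes v ->
  obstructed X u y = obstructed X v y /\ obstructed X y u = obstructed X y v.
Proof.
move=> uv; have E i : (0 < u 0 i) = (0 < v 0 i).
  by have := congr1 (fun S : {set 'I_M} => i \in S) uv; rewrite !inE.
split; apply/finset.setP => i; rewrite !inE ?E//.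
by congr (_ && _); apply/existsP/existsP => -[j jh]; exists j; rewrite ?E// -E.
Qed.

Definition ray xs w (t : R) : 'rV[R]_M := xs + t *: w.

(** The combinatorial data of the geodesics from xs + t w to x is the same for all
    t in (0, e): the obstructed axes A and B, the blocks L, and a list J of
    representatives of the blocks in the order of their times. *)
Record stable_blocks (E F : {set 'I_M}) (xs w x : 'rV[R]_M) (e : R)
    (A B : {set 'I_M}) (L : 'I_M -> {set 'I_M}) (J : seq 'I_M) : Prop := StableBlocks {
  stable_gt0 : 0 < e;
  stable_orthant : forall t, 0 < t < e -> orthant (E :|: F) (ray xs w t);
  stable_obstructedA : forall t, 0 < t < e -> obstructed X (ray xs w t) x = A;
  stable_obstructedB : forall t, 0 < t < e -> obstructed X x (ray xs w t) = B;
  stable_system : forall t, 0 < t < e -> block_system X (ray xs w t) x L;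
  stable_sub : forall j, j \in J -> j \in A :|: B;
  stable_path : forall t, 0 < t < e ->
    path <%R 0 [seq block_time X (ray xs w t) x L j | j <- J];
  stable_cover : forall t, 0 < t < e -> forall i, i \in A :|: B ->
    block_time X (ray xs w t) x L i \in [seq block_time X (ray xs w t) x L j | j <- J] /\
    forall j, j \in A :|: B ->
      block_time X (ray xs w t) x L i = block_time X (ray xs w t) x L j -> L i = L j }.

Lemma mass_weight_ex u y (S : {set 'I_M}) : 0 < mass (weight X u y) S ->
  exists2 k, k \in S & k \in obstructed X u y.
Proof.
move=> S0; have /existsP[k /andP[kS kA]] :
    [exists k, (k \in S) && (k \in obstructed X u y)].
  apply: contraTT S0 => /existsPn h; rewrite -leNgt /mass big1// => k kS.
  by have := h k; rewrite kS/= /weight => /negbTE ->.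
by exists k.
Qed.

Lemma block_time_lt u y L i j : block_system X u y L ->
  i \in obstructed X u y :|: obstructed X y u ->
  j \in obstructed X u y :|: obstructed X y u ->
  (block_time X u y L i < block_time X u y L j) =
  (mass (weight X u y) (L i) * mass (weight X y u) (L j) <
   mass (weight X u y) (L j) * mass (weight X y u) (L i)).
Proof.
move=> hL iI jI; have [ai bi] := sqrt_mass_gt0 hL iI.
have [aj bj] := sqrt_mass_gt0 hL jI.
have [pi0 qi0] := block_gt0 hL iI; have [pj0 qj0] := block_gt0 hL jI.
rewrite -[RHS]ltr_sqrt ?mulr_gt0// (sqrtrM _ (ltW pi0)) (sqrtrM _ (ltW pj0)).
rewrite /block_time ltr_pdivrMr ?addr_gt0// mulrAC ltr_pdivlMr ?addr_gt0//.
by apply/idP/idP; lra.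
Qed.

Variables (E F : {set 'I_M}) (xs w x : 'rV[R]_M).
Hypothesis hxs : orthant E xs.
Hypothesis wF : forall i, i \in F -> i \notin E /\ 0 < w 0 i.
Hypothesis w0 : forall i, i \notin E :|: F -> w 0 i = 0.

Local Notation z := (ray xs w).

Lemma rayE t i : z t 0 i = xs 0 i + t * w 0 i.
Proof. by rewrite !mxE. Qed.

Lemma cvg_ray i : z t 0 i @[t --> (0 : R)^'+] --> xs 0 i.
Proof.
have E0 : (fun t => z t 0 i) = horner ((xs 0 i)%:P + (w 0 i)%:P * 'X).
  by apply/funext => t; rewrite rayE !hornerE mulrC.
rewrite E0 -[X in _ --> X](_ : ((xs 0 i)%:P + (w 0 i)%:P * 'X).[0] = _); last first.
  by rewrite !hornerE; ring.
by apply: cvg_at_right_filter; exact: continuous_horner.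
Qed.

Lemma near_pos_ray : \forall t \near (0 : R)^'+, forall i, i \in E -> 0 < z t 0 i.
Proof.
apply: filter_forall => i; have [iE|iE] := boolP (i \in E); last by near=> t.
have xi : 0 < xs 0 i by have [h _] := hxs i; exact: h.
near=> t => _; near: t; exact: (cvgr_gt _ (@cvg_ray i)).
Unshelve. all: by end_near. Qed.

Lemma orthant_ray t : 0 < t -> (forall i, i \in E -> 0 < z t 0 i) ->
  orthant (E :|: F) (z t).
Proof.
move=> t0 posE i; rewrite finset.in_setU; split.
  move=> /orP[/posE//|iF]; have [iE wi] := wF iF.
  by have [_ xi] := hxs i; rewrite rayE xi// add0r mulr_gt0.
rewrite negb_or => /andP[iE iF]; have [_ xi] := hxs i.
by rewrite rayE xi// w0 ?mulr0 ?addr0// finset.in_setU negb_or iE.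
Qed.

(** Being an optimal system of blocks, and the order of the blocks, is decided by
    the signs of the polynomials P(S) Q(T) - P(T) Q(S) in t, where S and T are sets
    of axes.  On an interval where none of these signs changes, the blocks found
    at its midpoint are optimal everywhere. *)
Lemma perturbed_blocks : exists (e : R) (A B : {set 'I_M}) (L : 'I_M -> {set 'I_M})
    (J : seq 'I_M), stable_blocks E F xs w x e A B L J.
Proof.
have [e1 e10 he1] := near_right_itv near_pos_ray.
pose A := obstructed X (z (e1 / 2)) x; pose B := obstructed X x (z (e1 / 2)).
have orth t : 0 < t < e1 -> orthant (E :|: F) (z t).
  by move=> te; apply: orthant_ray; [case/andP: te|exact: he1].
have AB t : 0 < t < e1 -> obstructed X (z t) x = A /\ obstructed X x (z t) = B.
  move=> te; apply: obstructed_pos_axes.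
  by rewrite !(orthant_pos_axes (G := E :|: F))//; apply: orth => //; lra.
pose q i : R := if i \in B then x 0 i ^+ 2 else 0.
have qE t S : 0 < t < e1 -> mass (weight X x (z t)) S = mass q S.
  by move=> te; apply: eq_bigr => i _; rewrite /weight (AB t te).2.
pose p i : {poly R} := if i \in A then ((xs 0 i)%:P + (w 0 i)%:P * 'X) ^+ 2 else 0.
have pE t S : 0 < t < e1 -> mass (weight X (z t) x) S = (\sum_(i in S) p i).[t].
  move=> te; rewrite horner_sum; apply: eq_bigr => i _; rewrite /weight /p (AB t te).1.
  by case: ifP; rewrite ?horner0// !hornerE rayE mulrC.
pose f (S T : {set 'I_M}) : {poly R} :=
  (\sum_(i in S) p i) * (mass q T)%:P - (\sum_(i in T) p i) * (mass q S)%:P.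
have /choice[sg hsg] : forall ST : {set 'I_M} * {set 'I_M}, exists s : R,
    \forall t \near (0 : R)^'+, Num.sg (f ST.1 ST.2).[t] = s.
  by move=> ST; exact: poly_sign_right.
have [e2 e20 he2] := near_right_itv (filter_forall _ hsg).
pose e := Num.min e1 e2.
have e0 : 0 < e by rewrite lt_min e10.
have ee1 t : 0 < t < e -> 0 < t < e1.
  by rewrite lt_min => /andP[-> /andP[->]].
have cmp s t S T : 0 < s < e -> 0 < t < e ->
    (mass (weight X (z t) x) S * mass (weight X x (z t)) T <=
     mass (weight X (z t) x) T * mass (weight X x (z t)) S) =
    (mass (weight X (z s) x) S * mass (weight X x (z s)) T <=
     mass (weight X (z s) x) T * mass (weight X x (z s)) S).
  move=> se te; rewrite !qE ?ee1// !pE ?ee1//.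
  have fE r : (\sum_(i in S) p i).[r] * mass q T <= (\sum_(i in T) p i).[r] * mass q S
      = (Num.sg (f S T).[r] <= 0).
    by rewrite sgr_le0 /f !hornerE subr_le0.
  have e2' r : 0 < r < e -> 0 < r < e2 by rewrite lt_min => /andP[-> /andP[_ ->]].
  by rewrite !fE (he2 t (e2' t te) (S, T)) (he2 s (e2' s se) (S, T)).
pose t0 := e / 2.
have t0e : 0 < t0 < e by rewrite /t0; lra.
have [L [hL distinctL]] := block_system_exists X (z t0) x.
have [A0 B0] := AB t0 (ee1 _ t0e); rewrite A0 B0 in distinctL.
have block t : 0 < t < e -> block_system X (z t) x L.
  move=> te; have [At Bt] := AB t (ee1 _ te); split.
  - by have := block_refl hL; rewrite A0 B0 At Bt.
  - by have := block_sub hL; rewrite A0 B0 At Bt.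
  - exact: (block_eq hL).
  - move=> i iI; have [|p0 q0] := block_gt0 hL (i := i).
      by rewrite A0 B0 -At -Bt.
    have [k kL kA] := mass_weight_ex p0; have [k' kL' kB] := mass_weight_ex q0.
    split; [apply: (mass_weight_gt0 _ kL)|apply: (mass_weight_gt0 _ kL')].
      by rewrite At -A0.
    by rewrite Bt -B0.
  - move=> i j; rewrite (cmp t0)// => ij; apply: (block_order hL).
    by move: ij; rewrite /precedes A0 B0 At Bt.
  - move=> U i; rewrite At Bt => clU iI; rewrite (cmp t0)//.
    apply: (block_upper hL); rewrite A0 B0//.
    apply/closed_inP; have [sU cU] := closed_inP _ _ _ clU; split=> // k l kU lI kl.
    by apply: cU kU lI _; move: kl; rewrite /precedes A0 B0 At Bt.
have ltE t i j : 0 < t < e -> i \in A :|: B -> j \in A :|: B ->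
    (block_time X (z t) x L i < block_time X (z t) x L j) =
    (block_time X (z t0) x L i < block_time X (z t0) x L j).
  move=> te iI jI; have [At Bt] := AB t (ee1 _ te).
  rewrite (block_time_lt (block t te)) ?(block_time_lt (block t0 t0e)) ?A0 ?B0 ?At ?Bt//.
  by rewrite !ltNge (cmp t0).
have [J [sortJ JI coverJ]] :=
  @enum_levels _ _ _ (block_time X (z t0) x L) (A :|: B).
have distinct i j : i \in A :|: B -> j \in A :|: B ->
    block_time X (z t0) x L i = block_time X (z t0) x L j -> L i = L j.
  move=> iI jI ij; apply: distinctL => //.
  have := @block_time_lt (z t0) x L i j (block _ t0e).
  have := @block_time_lt (z t0) x L j i (block _ t0e).
  rewrite A0 B0 iI jI ij ltxx => /(_ isT isT)/esym/negbT + /(_ isT isT)/esym/negbT.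
  by rewrite -!leNgt => h1 h2; apply/le_anti; rewrite h1 h2.
exists e, A, B, L, J; split=> //.
- by move=> t te; exact/orth/ee1.
- by move=> t te; have [] := AB t (ee1 _ te).
- by move=> t te; have [] := AB t (ee1 _ te).
- move=> t te; have [At Bt] := AB t (ee1 _ te).
  rewrite (path_sortedE lt_trans); apply/andP; split.
    apply/allP => _ /mapP[j jJ ->].
    have jI : j \in obstructed X (z t) x :|: obstructed X x (z t).
      by rewrite At Bt; exact: JI.
    by have /andP[] := block_time01 (block t te) jI.
  move: sortJ; rewrite !sorted_map.
  apply: (@sub_in_sorted _ (mem (A :|: B))); last by apply/allP => j /JI.
  by move=> i j iI jI /=; rewrite (ltE t).
- move=> t te i iI; split.
    have /mapP[j jJ ij] := coverJ i iI; apply/mapP; exists j => //.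
    by rewrite /block_time (distinct i j)//; exact: JI.
  move=> j jI ij; apply: distinct => //.
  by apply/le_anti; rewrite !leNgt -!(ltE t)// ij ltxx.
Qed.

End Perturbation.

(** * The limit of the translated logarithm *)

Section Limit.
Variables (R : realType) (M m : nat) (X : set 'rV[R]_M).
Hypothesis hX : orthant_space m X.
Implicit Types (u v y : 'rV[R]_M) (i j : 'I_M).

(** The sequence of axes of the support for S = A or S = B; its first entry is the
    set of common axes, expressed by the strata of the two end points. *)
Definition support_side (E F : {set 'I_M}) (x : 'rV[R]_M) (A B : {set 'I_M})
    (L : 'I_M -> {set 'I_M}) (J : seq 'I_M) (S : {set 'I_M}) : seq {set 'I_M} :=
  (E :|: F :|: pos_axes x) :\: (A :|: B) :: [seq S :&: L j | j <- J].

Lemma enorm_proj (S : {set 'I_M}) u :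
  enorm (proj S u) = Num.sqrt (\sum_(i in S) u 0 i ^+ 2).
Proof.
congr Num.sqrt; rewrite [RHS]big_mkcond; apply: eq_bigr => i _; rewrite mxE.
by case: ifP => // _; rewrite expr0n.
Qed.

Lemma sqrt_mass_weight u y (S : {set 'I_M}) :
  Num.sqrt (mass (weight X u y) S) = enorm (proj (obstructed X u y :&: S) u).
Proof.
rewrite enorm_proj; congr Num.sqrt; rewrite /mass [LHS]big_mkcond [RHS]big_mkcond.
apply: eq_bigr => i _.
by rewrite finset.in_setI /weight; case: (i \in S); case: (i \in obstructed X u y).
Qed.

Variables (E F : {set 'I_M}) (xs w x : 'rV[R]_M).
Hypotheses (hEF : stratum X (E :|: F)) (hxs : orthant E xs) (hx : X x).

Local Notation z := (ray xs w).

Lemma cvg_ray_sum_sqr (S : {set 'I_M}) :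
  \sum_(i in S) z t 0 i ^+ 2 @[t --> (0 : R)^'+] --> \sum_(i in S) xs 0 i ^+ 2.
Proof.
apply: cvg_big => [|i _]; first by move=> u; exact: add_continuous.
rewrite expr2; under eq_cvg do rewrite expr2.
by apply: cvgM; exact: cvg_ray.
Qed.

(** This is where the two cases of [limit_direction] come from: if S contains an
    axis of E, then the direction of the projection to S converges to that of xs,
    and otherwise it is that of w for all t > 0. *)
Lemma cvg_unit_coord (S : {set 'I_M}) i : S \subset E :|: F -> i \in S ->
  z t 0 i / enorm (proj S (z t)) @[t --> (0 : R)^'+] -->
  limit_direction E F xs w S 0 i / enorm (limit_direction E F xs w S).
Proof.
move=> SEF iS; have xsE j : j \notin E -> xs 0 j = 0 by have [] := hxs j.
rewrite /limit_direction; case: ifPn => [/eqP W0|W0].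
  have xs0 j : j \in S -> xs 0 j = 0.
    move=> jS; have [jE|/xsE//] := boolP (j \in E).
    by have := congr1 (fun u : 'rV_M => u 0 j) W0; rewrite !mxE finset.in_setI jS jE.
  have SF j : j \in S -> j \in F.
    move=> jS; have := fintype.subsetP SEF j jS; rewrite finset.in_setU => /orP[jE|//].
    by have [/(_ jE)] := hxs j; rewrite xs0// ltxx.
  have -> : S :&: F = S.
    by apply/finset.setIidPl/fintype.subsetP.
  apply: cvg_near_cst; near=> t.
  have t0 : 0 < t by near: t; exact: nbhs_right_gt.
  have -> : proj S (z t) = t *: proj S w.
    apply/rowP => j; rewrite !mxE; case: ifP => [jS|_]; last by rewrite mulr0.
    by rewrite xs0// add0r.
  by rewrite enormZ gtr0_norm// !mxE iS xs0// add0r invfM mulrACA divff ?mul1r.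
have SE : proj (S :&: E) xs = proj S xs.
  apply/rowP => j; rewrite !mxE finset.in_setI; case: (j \in S) => //=.
  by case: ifPn => // /xsE.
rewrite SE in W0 *; rewrite [proj S xs 0 i]mxE iS.
have en0 : enorm (proj S xs) != 0.
  apply: contra W0 => /eqP en; apply/eqP/rowP => j; rewrite [RHS]mxE.
  have := coord_le_enorm (proj S xs) j; rewrite en normr_le0 => /eqP //.
apply: cvgM; first exact: cvg_ray.
apply: cvgV => //.
rewrite enorm_proj; under eq_cvg do rewrite enorm_proj.
apply: continuous_cvg; first exact: sqrt_continuous.
exact: cvg_ray_sum_sqr.
Unshelve. all: by end_near. Qed.

Variables (e : R) (A B : {set 'I_M}) (L : 'I_M -> {set 'I_M}) (J : seq 'I_M).
Hypothesis hJ : stable_blocks X E F xs w x e A B L J.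
Let e0 : 0 < e := stable_gt0 hJ.
Let orthz t (te : 0 < t < e) := stable_orthant hJ te.
Let obsA t (te : 0 < t < e) := stable_obstructedA hJ te.
Let obsB t (te : 0 < t < e) := stable_obstructedB hJ te.
Let blockz t (te : 0 < t < e) := stable_system hJ te.

Definition limit_Phi : 'rV[R]_M := \row_i
  (if i \in A then
     let W := limit_direction E F xs w (A :&: L i) in
     - (enorm (proj (B :&: L i) x) / enorm W) * W 0 i
   else if i \in B then 0 else x 0 i).

Lemma half_inside : 0 < e / 2 < e.
Proof. by have := stable_gt0 hJ; lra. Qed.

Lemma departing_sub : A \subset E :|: F.
Proof.
have te := half_inside.
rewrite -(obsA te) -(orthant_pos_axes (orthz te)); apply/fintype.subsetP => i iA.
by rewrite inE; exact: obstructed_gt0 iA.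
Qed.

Lemma cvg_Phi_ray : Phi X x (z t) @[t --> (0 : R)^'+] --> limit_Phi.
Proof.
apply: (@cvg_trans _ ((\row_i (if i \in A then
    - (enorm (proj (B :&: L i) x) * (z t 0 i / enorm (proj (A :&: L i) (z t))))
    else if i \in B then 0 else x 0 i) : 'rV[R]_M) @[t --> (0 : R)^'+])).
  apply: near_eq_cvg; near=> t.
  have te : 0 < t < e.
    by apply/andP; split; near: t; [exact: nbhs_right_gt|exact: nbhs_right_lt].
  have Xz : X (z t) by exact/hEF/orthz.
  rewrite (Phi_blocks hX Xz hx (blockz te)); apply/rowP => i; rewrite !mxE.
  rewrite !sqrt_mass_weight obsA// obsB//; case: ifP => // iA.
  by rewrite mulNr mulrAC mulrA.
apply: cvg_row => i; rewrite mxE; under eq_cvg do rewrite mxE.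
case: ifPn => iA; last exact: cvg_cst.
have iL : i \in L i.
  have te := half_inside.
  by apply: (block_refl (blockz te)); rewrite finset.in_setU (obsA te) iA.
rewrite /= mulNr mulrAC -mulrA; apply: cvgN.
apply: cvgM; first exact: cvg_cst.
apply: cvg_unit_coord; last by rewrite finset.in_setI iA.
by apply: fintype.subset_trans departing_sub; exact: subsetIl.
Unshelve. all: by end_near. Qed.

Lemma geodesic_point_ray t : 0 < t < e -> geodesic_point X xs t w = z t.
Proof.
move=> te; have /andP[t0 _] := te.
have posz i : (0 < z t 0 i) = (i \in E :|: F).
  by rewrite -(orthant_pos_axes (orthz te)) inE.
have posx i : 0 < xs 0 i -> i \in E.
  by rewrite -(orthant_pos_axes hxs) inE.
apply: (geodesic_pointE hX).
- by apply: (stratum_sub hX hEF (finset.subsetUl _ _)).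
- exact/hEF/orthz.
- exact: ltW.
- by move=> i /posx iE; rewrite posz finset.in_setU iE.
- move=> i j /posx iE; rewrite posz => jEF.
  by move/(stratumP hX): hEF; apply => //; rewrite finset.in_setU iE.
Qed.

Lemma cvg_Phi_geodesic_point :
  Phi X x (geodesic_point X xs t w) @[t --> (0 : R)^'+] --> limit_Phi.
Proof.
apply: cvg_trans cvg_Phi_ray; apply: near_eq_cvg; near=> t.
rewrite geodesic_point_ray//.
by apply/andP; split; near: t; [exact: nbhs_right_gt|exact: nbhs_right_lt].
Unshelve. all: by end_near. Qed.

(** The conditions of [block_system] are nonstrict inequalities between
    polynomials in t, so they hold at t = 0.  The weights stay positive there
    because the axes of A are axes of xs. *)
Lemma limit_Phi_tangent : F = finset.set0 -> limit_Phi = Phi X x xs.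
Proof.
move=> F0; have te := half_inside.
have [A0 B0] : obstructed X xs x = A /\ obstructed X x xs = B.
  rewrite -(obsA te) -(obsB te); apply: obstructed_pos_axes.
  by rewrite (orthant_pos_axes hxs) (orthant_pos_axes (orthz te)) F0 finset.setU0.
have hz0 : X xs by apply: (stratum_sub hX hEF (finset.subsetUl _ _)).
have mq t S : 0 < t < e -> mass (weight X x (z t)) S = mass (weight X x xs) S.
  by move=> t_e; apply: eq_bigr => i _; rewrite /weight (obsB t_e) B0.
have mp S : mass (weight X (z t) x) S @[t --> (0 : R)^'+] --> mass (weight X xs x) S.
  have E0 (u : 'rV[R]_M) : obstructed X u x = A ->
      mass (weight X u x) S = \sum_(i in A :&: S) u 0 i ^+ 2.
    move=> uA; rewrite /mass [LHS]big_mkcond [RHS]big_mkcond; apply: eq_bigr => i _.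
    by rewrite finset.in_setI /weight uA; case: (i \in S); case: (i \in A).
  rewrite (E0 xs A0); apply: cvg_trans (@cvg_ray_sum_sqr (A :&: S)).
  apply: near_eq_cvg; near=> t; rewrite E0// obsA//.
  by apply/andP; split; near: t; [exact: nbhs_right_gt|exact: nbhs_right_lt].
have le_lim (S T : {set 'I_M}) (c d : R) : (forall t, 0 < t < e ->
    mass (weight X (z t) x) S * c <= mass (weight X (z t) x) T * d) ->
    mass (weight X xs x) S * c <= mass (weight X xs x) T * d.
  move=> h; apply: (ler_cvg_to (cvgM (mp S) (cvg_cst c)) (cvgM (mp T) (cvg_cst d))).
  near=> t; apply: h.
  by apply/andP; split; near: t; [exact: nbhs_right_gt|exact: nbhs_right_lt].
have hL := blockz te.
have block0 : block_system X xs x L.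
  split.
  - by have := block_refl hL; rewrite A0 B0 obsA// obsB.
  - by have := block_sub hL; rewrite A0 B0 obsA// obsB.
  - exact: (block_eq hL).
  - move=> i iI; have [|p0 q0] := block_gt0 hL (i := i).
      by rewrite (obsA te) (obsB te) -A0 -B0.
    have [k kL kA] := mass_weight_ex p0; rewrite -(mq _ _ te); split=> //.
    by apply: (mass_weight_gt0 _ kL); rewrite A0 -(obsA te).
  - move=> i j ij; apply: le_lim => t t_e; rewrite -!(mq _ _ t_e).
    apply: (block_order (blockz t_e)).
    by move: ij; rewrite /precedes A0 B0 obsA// obsB.
  - move=> U i; rewrite A0 B0 => clU iI; apply: le_lim => t t_e; rewrite -!(mq _ _ t_e).
    apply: (block_upper (blockz t_e)); rewrite obsA// obsB//.
    apply/closed_inP; have [sU cU] := closed_inP _ _ _ clU; split=> // k l kU lI kl.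
    by apply: cU kU lI _; move: kl; rewrite /precedes A0 B0 obsA// obsB.
rewrite (Phi_blocks hX hz0 hx block0); apply/rowP => i; rewrite !mxE A0 B0.
case: ifPn => // iA; rewrite !sqrt_mass_weight A0 B0.
have WE : limit_direction E F xs w (A :&: L i) = proj (A :&: L i) xs.
  have AE : (A :&: L i) :&: E = A :&: L i.
    apply/finset.setIidPl/fintype.subsetP => j /finset.setIP[jA _].
    by have := fintype.subsetP departing_sub j jA; rewrite F0 finset.setU0.
  rewrite /limit_direction AE; case: ifPn => // /eqP W0.
  have [|p0 _] := block_gt0 block0 (i := i); first by rewrite A0 finset.in_setU iA.
  move: p0; rewrite -sqrtr_gt0 sqrt_mass_weight A0 W0.
  by rewrite /enorm big1 ?sqrtr0 ?ltxx// => j _; rewrite mxE expr0n.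
rewrite WE /= [proj _ xs 0 i]mxE finset.in_setI iA.
by rewrite (block_refl block0) // A0 B0 finset.in_setU iA.
Unshelve. all: by end_near. Qed.

Local Notation C := ((E :|: F :|: pos_axes x) :\: (A :|: B)).
Local Notation As := (support_side E F x A B L J A).
Local Notation Bs := (support_side E F x A B L J B).

Lemma common_axes_ray t : 0 < t < e -> common_axes X (z t) x = C.
Proof.
move=> te; have Xz : X (z t) by exact/hEF/orthz.
by rewrite (common_axesE hX Xz hx) obsA// obsB// (orthant_pos_axes (orthz te)).
Qed.

Lemma is_support_ray t : 0 < t < e -> is_support X (z t) x As Bs.
Proof.
move=> te; have Xz : X (z t) by exact/hEF/orthz.
have hL := blockz te; have hS := schedule_blocks hX Xz hL.
have At := obsA te; have Bt := obsB te.
have level (D : {set 'I_M}) j : D \subset A :|: B -> j \in J ->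
    D :&: [set i | block_time X (z t) x L i == block_time X (z t) x L j]%SET
    = D :&: L j.
  move=> DI jJ; apply/finset.setP => i; rewrite !finset.in_setI.
  have [iD/=|//] := boolP (i \in D); rewrite inE.
  have iI := fintype.subsetP DI i iD.
  apply/eqP/idP => [ij|iL]; last exact: (block_time_const hL iL).
  have [_ /(_ j (stable_sub hJ jJ) ij) <-] := stable_cover hJ te iI.
  by apply: (block_refl hL); rewrite At Bt.
have := @is_support_levels _ _ _ _ hX (z t) x (block_time X (z t) x L) J Xz hx hS.
rewrite At Bt common_axes_ray// /support_side.
have -> : [seq A :&: [set i | block_time X (z t) x L i == block_time X (z t) x L j]%SET
    | j <- J] = [seq A :&: L j | j <- J].
  by apply/eq_in_map => j jJ; apply: level => //; exact: finset.subsetUl.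
have -> : [seq B :&: [set i | block_time X (z t) x L i == block_time X (z t) x L j]%SET
    | j <- J] = [seq B :&: L j | j <- J].
  by apply/eq_in_map => j jJ; apply: level => //; exact: finset.subsetUr.
apply.
- exact: (stable_path hJ te).
- exact: (stable_sub hJ).
- by move=> i iI; have [] := stable_cover hJ te iI.
- move=> j jJ; have [|p0 _] := block_gt0 hL (i := j); first by rewrite At Bt (stable_sub hJ jJ).
  have [k kL kA] := mass_weight_ex p0; exists k; first by rewrite -At.
  exact: (block_time_const hL kL).
- move=> j jJ; have [|_ q0] := block_gt0 hL (i := j); first by rewrite At Bt (stable_sub hJ jJ).
  have [k kL kB] := mass_weight_ex q0; exists k; first by rewrite -Bt.
  exact: (block_time_const hL kL).
Qed.

Lemma limit_PhiE : limit_Phi = limit_formula E F x xs w As Bs.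
Proof.
have te := half_inside; have hL := blockz te; have At := obsA te; have Bt := obsB te.
have Xz : X (z (e / 2)) by exact/hEF/orthz.
apply/rowP => k.
pose term (j : 'I_M) : R :=
  let W := limit_direction E F xs w (A :&: L j) in
  - (enorm (proj (B :&: L j) x) / enorm W) * W 0 k.
have -> : limit_formula E F x xs w As Bs 0 k = (if k \in C then x 0 k else 0) +
    \sum_(n < size J) (if k \in A :&: L (nth k J n) then term (nth k J n) else 0).
  rewrite /limit_formula /jmath /= size_map big_ord_recl mxE summxE /=.
  congr (_ + _); first by rewrite !mxE; case: ifP => // ->.
  apply: eq_bigr => n _; rewrite mxE /=.
  by rewrite add0n !(nth_map k)//; case: ifP => // _; rewrite mxE.
rewrite mxE.
have [kA|kA] := boolP (k \in A).
  have kI : k \in A :|: B by rewrite finset.in_setU kA.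
  have -> : k \in C = false by rewrite finset.in_setD kI.
  have [/mapP[j jJ kj] distinct] := stable_cover hJ te kI.
  have Lkj : L k = L j by apply: distinct => //; exact: (stable_sub hJ).
  have jn : (index j J < size J)%N by rewrite index_mem.
  have kL : k \in L k by apply: (block_refl hL); rewrite At Bt.
  (* The blocks represented in J are disjoint: only that of k contributes. *)
  rewrite add0r (bigD1 (Ordinal jn))//= nth_index// big1 => [|n].
    by rewrite addr0 finset.in_setI kA -Lkj kL /term -Lkj.
  move=> /eqP nj; case: ifP => // /finset.setIP[_ kLn]; exfalso; apply: nj.
  apply/val_inj => /=.
  have node : block_time X (z (e / 2)) x L (nth k J n) =
            block_time X (z (e / 2)) x L (nth k J (index j J)).
    by rewrite nth_index// -kj (block_time_const hL kLn).
  have uT := lt_sorted_uniq (path_sorted (stable_path hJ te)).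
  apply/eqP; rewrite -(nth_uniq 0 _ _ uT) ?size_map//.
  by rewrite !(nth_map k)// node.
rewrite big1 ?addr0 => [|n _]; last by rewrite finset.in_setI (negbTE kA).
rewrite finset.in_setD !finset.in_setU (negbTE kA)/=.
have [kB//|kB/=] := boolP (k \in B).
have [//|] := boolP (_ || _); rewrite negb_or inE => /andP[_ xk].
by apply/le_anti; rewrite (coord_ge0 hX)// andbT leNgt xk.
Qed.

End Limit.

Theorem theorem2 (R : realType) (M m : nat) (X : set 'rV[R]_M)
    (E : {set 'I_M}) (xs x : 'rV[R]_M)
    (hX : orthant_space m X) (hE : stratum X E)
    (hxs : orthant E xs) (hx : X x) :
  (forall w : 'rV[R]_M, coord_space E w ->
     Phi X x (geodesic_point X xs lam w) @[lam --> 0^'+] --> Phi X x xs)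
  /\
  (forall (F : {set 'I_M}) (w : 'rV[R]_M),
     F != finset.set0 -> [disjoint E & F]%B -> stratum X (E :|: F) ->
     tangent_vectors E F w ->
     cvg (Phi X x (geodesic_point X xs lam w) @[lam --> 0^'+])
     /\
     exists (eps : R) (A B : seq {set 'I_M}),
       [/\ 0 < eps,
           (forall lam : R, 0 < lam < eps ->
              is_support X (geodesic_point X xs lam w) x A B) &
           Psi X x w xs = limit_formula E F x xs w A B]).
Proof.
split=> [w wE|F w _ EF hEF [u [v [uE vF wE]]]].
  have w0 i : i \notin E :|: finset.set0 -> w 0 i = 0.
    by rewrite finset.setU0; exact: wE.
  have wF i : i \in (finset.set0 : {set 'I_M}) -> i \notin E /\ 0 < w 0 i.
    by rewrite inE.
  have hE0 : stratum X (E :|: finset.set0) by rewrite finset.setU0.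
  have [e [A [B [L [J hJ]]]]] := perturbed_blocks X x hxs wF w0.
  rewrite -(limit_Phi_tangent hX hE0 hxs hx hJ)//.
  exact: (cvg_Phi_geodesic_point hX hE0 hxs hx hJ).
have FE i : i \in F -> i \notin E.
  by move=> iF; apply/negP => iE; move/pred0P: EF => /(_ i)/=; rewrite iE iF.
have wF i : i \in F -> i \notin E /\ 0 < w 0 i.
  move=> iF; have iE := FE i iF; split=> //.
  by rewrite wE mxE uE// add0r; have [h _] := vF i; exact: h.
have w0 i : i \notin E :|: F -> w 0 i = 0.
  rewrite finset.in_setU negb_or => /andP[iE iF].
  by rewrite wE mxE uE// add0r; have [_ h] := vF i; exact: h.
have [e [A [B [L [J hJ]]]]] := perturbed_blocks X x hxs wF w0.
have lim := cvg_Phi_geodesic_point hX hEF hxs hx hJ.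
split; first by apply/cvg_ex; eexists; exact: lim.
exists e, (support_side E F x A B L J A), (support_side E F x A B L J B).
split; first exact: (stable_gt0 hJ).
  move=> t te; rewrite (geodesic_point_ray hX hEF hxs hJ)//.
  exact: (is_support_ray hX hEF hx hJ).
rewrite /Psi (cvg_lim _ lim); last exact: norm_hausdorff.
exact: (limit_PhiE hX hEF hx hJ).
Qed.
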